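(* Assume that the maps $\underline\sigma^m$, $\underline f^m$, $g^m$ and $\Sigma^m$, $m\in\mathcal M$, are bounded (in $x$ and $u$). Then there exists a constant $K$ depending on these bounds such that, for any $0<\epsilon\le1$, any $\tilde K$ and any $v\in\mathcal C^\infty_{\rm b}([0,T]\times\mathbb R^d)$ satisfying $$|\partial_t^pD^qv|\le\tilde K\,\epsilon^{1-2p-q}\qquad\text{for all }p,q\in\mathbb N,$$ we have, for all $t\in\mathcal T_h$ and $x\in\mathbb R^d$, $$\Big|\mathcal K(h,t,x,v(t,x),v)+\frac{\partial v}{\partial t}(t,x)+\mathcal H(x,v(t,x),Dv(t,x),D^2v(t,x))\Big|\le E(\tilde K,h,\epsilon),$$ with $$E(\tilde K,h,\epsilon)=K\tilde K\Big(h\epsilon^{-3}(1+\sqrt h)^4(1+\sqrt h\,\epsilon^{-1})^4+\sqrt h\,\epsilon^{-1}(1+\sqrt h)^2(1+\sqrt h\,\epsilon^{-1})^2\Big).$$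
   Context: **Hamiltonian.** $\mathcal M$ is a finite set, $\mathcal U\subset\mathbb R^p$, $T>0$. For $m\in\mathcal M$, the maps $f^m:\mathbb R^d\times\mathcal U\to\mathbb R^d$, $\sigma^m:\mathbb R^d\times\mathcal U\to\mathbb R^{d\times d}$, $\delta^m,\ell^m:\mathbb R^d\times\mathcal U\to\mathbb R$ are continuous. For $x\in\mathbb R^d$, $r\in\mathbb R$, $p\in\mathbb R^d$ and $\Gamma$ a symmetric $d\times d$ matrix, $$\mathcal H(x,r,p,\Gamma)=\max_{m\in\mathcal M,\,u\in\mathcal U}\Big\{\tfrac12\operatorname{tr}(\sigma^m(x,u)\sigma^m(x,u)^{\mathsf T}\Gamma)+f^m(x,u)\cdot p-\delta^m(x,u)r+\ell^m(x,u)\Big\}.$$ **Decomposition.** For $m\in\mathcal M$, $\underline f^m:\mathbb R^d\to\mathbb R^d$ and $\underline\sigma^m:\mathbb R^d\to\mathbb R^{d\times d}$ are such that $a^m(x)=\underline\sigma^m(x)\underline\sigma^m(x)^{\mathsf T}$ is positive definite and $a^m(x)\le\sigma^m(x,u)\sigma^m(x,u)^{\mathsf T}$ (Loewner order) for all $x,u$. $\Sigma^m(x,u)$ is any $d\times\ell$ matrix (for some integer $\ell$) and $g^m(x,u)\in\mathbb R^d$ is the vector such that $$\sigma^m(x,u)\sigma^m(x,u)^{\mathsf T}-a^m(x)=\underline\sigma^m(x)\Sigma^m(x,u)\Sigma^m(x,u)^{\mathsf T}\underline\sigma^m(x)^{\mathsf T},\qquad f^m(x,u)-\underline f^m(x)=\underline\sigma^m(x)g^m(x,u).$$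 **Scheme.** $h>0$ is such that $T/h$ is an integer, $\mathcal T_h=\{0,h,\dots,T-h\}$, $\overline{\mathcal T}_h=\{0,h,\dots,T\}$. $(W_s)$ is a $d$-dimensional Brownian motion and $\hat X^m(t+h)=\hat X^m(t)+\underline f^m(\hat X^m(t))h+\underline\sigma^m(\hat X^m(t))(W_{t+h}-W_t)$. An integer $k\ge0$ is fixed. For $g,w\in\mathbb R^d$, $\mathcal P^1_g(w)=2(g_+\cdot w_++g_-\cdot w_-)$, with componentwise positive and negative parts $[\mu_+]_i=\max([\mu]_i,0)$, $[\mu_-]_i=-\min([\mu]_i,0)$. For $\Sigma\in\mathbb R^{d\times\ell}$ with columns $\Sigma_{.j}$, $$\mathcal P^2_{\Sigma,k}(w)=\sum_{j=1}^\ell\|\Sigma_{.j}\|_2^2\Big(c_k\Big(\tfrac{[\Sigma^{\mathsf T}w]_j}{\|\Sigma_{.j}\|_2}\Big)^{4k+2}-d_k\Big),\quad c_k=\tfrac1{(4k+2)\mathbb E[N^{4k+2}]},\quad d_k=\tfrac1{4k+2},$$ $N$ a standard normal variable, the $j$th term being zero if $\|\Sigma_{.j}\|_2=0$. For $\phi:\overline{\mathcal T}_h\times\mathbb R^d\to\mathbb R$, $(t,x)\in\mathcal T_h\times\mathbb R^d$, $r\in\mathbb R$: \begin{align*} \mathcal D^0_{t,h,m}(\phi)(t,x)&=\mathbb E[\phi(t+h,\hat X^m(t+h))\mid\hat X^m(t)=x],\\ \mathcal D^1_{t,h,m,g}(r,\phi)(t,x)&=\mathbb E[(\phi(t+h,\hat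 X^m(t+h))-r)\mathcal P^1_g(h^{-1}(W_{t+h}-W_t))\mid\hat X^m(t)=x],\\ \mathcal D^2_{t,h,m,\Sigma,k}(\phi)(t,x)&=h^{-1}\mathbb E[\phi(t+h,\hat X^m(t+h))\mathcal P^2_{\Sigma,k}(h^{-1/2}(W_{t+h}-W_t))\mid\hat X^m(t)=x], \end{align*} \begin{align*} \mathcal K(h,t,x,r,\phi)=-\max_{m\in\mathcal M,\,u\in\mathcal U}\Big\{&h^{-1}(\mathcal D^0_{t,h,m}(\phi)(t,x)-r)+\ell^m(x,u)-\delta^m(x,u)r\\ &+\mathcal D^1_{t,h,m,g^m(x,u)}(r,\phi)(t,x)+\mathcal D^2_{t,h,m,\Sigma^m(x,u),k}(\phi)(t,x)\Big\}. \end{align*} The maxima over $\mathcal U$ are implicitly assumed to be attained. **Notation.** $\mathcal C^\infty_{\rm b}([0,T]\times\mathbb R^d)$ is the set of smooth functions with all partial derivatives (of all orders) bounded; such a $v$ is restricted to $\overline{\mathcal T}_h\times\mathbb R^d$ in $\mathcal K$. $|\partial_t^pD^qv|$ is the supremum over $(t,x)\in[0,T]\times\mathbb R^d$ and $\beta\in\mathbb N^d$ with $\sum_i\beta_i=q$ of $\big|\frac{\partial^{p+q}v}{\partial t^p\partial x_1^{\beta_1}\cdots\partial x_d^{\beta_d}}(t,x)\big|$. $K$ does not depend on $h,t,x,v,\epsilon,\tilde K$ ($d$ and $k$ are fixed). *)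

(* Defs.v *)
From HB Require Import structures.
From mathcomp Require Import all_boot all_order all_algebra.
From mathcomp Require Import all_classical all_reals all_analysis.

Set Implicit Arguments.
Unset Strict Implicit.
Unset Printing Implicit Defensive.

Import Order.TTheory GRing.Theory Num.Theory.
Import numFieldNormedType.Exports.

Local Open Scope classical_set_scope.
Local Open Scope ring_scope.

Definition dotp (R : realType) (n : nat) (u w : 'cV[R]_n) : R :=
  \sum_i u i 0 * w i 0.

(* Euclidean norm of a column vector, Frobenius norm of a matrix. *)
Definition norm2 (R : realType) (m n : nat) (A : 'M[R]_(m, n)) : R :=
  Num.sqrt (\sum_i \sum_j A i j ^+ 2).

Definition quadform (R : realType) (n : nat) (A : 'M[R]_n) (y : 'cV[R]_n) : R :=
  dotp y (A *m y).

(* Symmetry is part of positive definiteness and of the Loewner order. *)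
Definition posdef (R : realType) (n : nat) (A : 'M[R]_n) : Prop :=
  A^T = A /\ forall y, y != 0 -> 0 < quadform A y.

Definition loewner_le (R : realType) (n : nat) (A B : 'M[R]_n) : Prop :=
  [/\ A^T = A, B^T = B & forall y, 0 <= quadform (B - A) y].

(* A maximum is written [sup A]; it is one only under [max_attained A]. *)
Definition max_attained (R : realType) (A : set R) : Prop :=
  exists2 y, A y & ubound A y.

Definition hamiltonian_set (R : realType) (M : finType) (d p : nat)
    (U : set 'cV[R]_p)
    (f : M -> 'cV[R]_d -> 'cV[R]_p -> 'cV[R]_d)
    (sigma : M -> 'cV[R]_d -> 'cV[R]_p -> 'M[R]_d)
    (delta ell : M -> 'cV[R]_d -> 'cV[R]_p -> R)
    (x : 'cV[R]_d) (r : R) (q : 'cV[R]_d) (Gam : 'M[R]_d) : set R :=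
  [set y | exists m u, U u /\
    y = 2^-1 * \tr (sigma m x u *m (sigma m x u)^T *m Gam)
        + dotp (f m x u) q - delta m x u * r + ell m x u].

Definition hamiltonian (R : realType) (M : finType) (d p : nat)
    (U : set 'cV[R]_p)
    (f : M -> 'cV[R]_d -> 'cV[R]_p -> 'cV[R]_d)
    (sigma : M -> 'cV[R]_d -> 'cV[R]_p -> 'M[R]_d)
    (delta ell : M -> 'cV[R]_d -> 'cV[R]_p -> R)
    (x : 'cV[R]_d) (r : R) (q : 'cV[R]_d) (Gam : 'M[R]_d) : R :=
  sup (hamiltonian_set U f sigma delta ell x r q Gam).

Definition continuous_coef (R : realType) (d p : nat) (V : topologicalType)
    (U : set 'cV[R]_p) (F : 'cV[R]_d -> 'cV[R]_p -> V) : Prop :=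
  {within [set z : 'cV[R]_d * 'cV[R]_p | U z.2],
    continuous (fun z : 'cV[R]_d * 'cV[R]_p => F z.1 z.2)}.

(* [fl], [sl] are the underlined drift and diffusion coefficients. *)
Definition decomposition (R : realType) (M : finType) (d p l : nat)
    (U : set 'cV[R]_p)
    (f : M -> 'cV[R]_d -> 'cV[R]_p -> 'cV[R]_d)
    (sigma : M -> 'cV[R]_d -> 'cV[R]_p -> 'M[R]_d)
    (fl : M -> 'cV[R]_d -> 'cV[R]_d) (sl : M -> 'cV[R]_d -> 'M[R]_d)
    (g : M -> 'cV[R]_d -> 'cV[R]_p -> 'cV[R]_d)
    (Sig : M -> 'cV[R]_d -> 'cV[R]_p -> 'M[R]_(d, l)) : Prop :=
  (forall m x, posdef (sl m x *m (sl m x)^T)) /\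
  forall m x u, U u ->
    [/\ loewner_le (sl m x *m (sl m x)^T) (sigma m x u *m (sigma m x u)^T),
        sigma m x u *m (sigma m x u)^T - sl m x *m (sl m x)^T
          = sl m x *m Sig m x u *m (Sig m x u)^T *m (sl m x)^T
      & f m x u - fl m x = sl m x *m g m x u].

Definition mutually_independent (R : realType) (dO : measure_display)
    (Omega : measurableType dO) (P : probability Omega R)
    (I : finType) (X : I -> Omega -> R) : Prop :=
  forall A : I -> set R, (forall i, measurable (A i)) ->
    P [set w | forall i, A i (X i w)] = (\prod_i fine (P (X i @^-1` A i)))%:E.

(* [W s] is unconstrained for s < 0.
   The scalar increments over consecutive intervals, all coordinates together,
   are mutually independent: this gives both the independence of the vector
   increments and that of the coordinates. *)
Definition brownian_motion (R : realType) (d : nat) (dO : measure_display)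
    (Omega : measurableType dO) (P : probability Omega R)
    (W : R -> Omega -> 'cV[R]_d) : Prop :=
  [/\ forall s i, 0 <= s -> measurable_fun setT (fun w => W s w i 0),
      {ae P, forall w, W 0 w = 0},
      {ae P, forall w, {within [set s : R | 0 <= s], continuous (W ^~ w)}},
      forall s t i, 0 <= s -> s < t -> forall A : set R, measurable A ->
        P [set w | A ((W t w - W s w) i 0)]
          = normal_prob 0 (Num.sqrt (t - s)) A
    & forall (n : nat) (t : nat -> R), 0 <= t 0%N ->
        {homo t : i j / (i <= j)%N >-> i <= j} ->
        mutually_independent P
          (fun (a : 'I_n * 'I_d) w => (W (t a.1.+1) w - W (t a.1) w) a.2 0)].

Definition time_grid (R : realType) (h T : R) : set R :=
  [set t | exists2 n : nat, t = n%:R * h & t <= T - h].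

Definition posvec (R : realType) (n : nat) (w : 'cV[R]_n) : 'cV[R]_n :=
  \col_i Num.max (w i 0) 0.

Definition negvec (R : realType) (n : nat) (w : 'cV[R]_n) : 'cV[R]_n :=
  \col_i - Num.min (w i 0) 0.

Definition poly1 (R : realType) (d : nat) (g w : 'cV[R]_d) : R :=
  2 * (dotp (posvec g) (posvec w) + dotp (negvec g) (negvec w)).

Definition normal_moment (R : realType) (n : nat) : R :=
  fine 'E_(normal_prob (0 : R) 1)[(fun y : R => y ^+ n)%R]%E.

Definition c_coef (R : realType) (k : nat) : R :=
  ((4 * k + 2)%:R * normal_moment R (4 * k + 2))^-1.

Definition d_coef (R : realType) (k : nat) : R := (4 * k + 2)%:R^-1.

Definition poly2 (R : realType) (d l : nat) (Sig : 'M[R]_(d, l)) (k : nat)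
    (w : 'cV[R]_d) : R :=
  \sum_(j < l)
    if norm2 (col j Sig) == 0 then 0 else
    norm2 (col j Sig) ^+ 2 *
      (c_coef R k * ((Sig^T *m w) j 0 / norm2 (col j Sig)) ^+ (4 * k + 2)
       - d_coef R k).

Definition euler_step (R : realType) (d : nat) (h : R) (fl : 'cV[R]_d -> 'cV[R]_d)
    (sl : 'cV[R]_d -> 'M[R]_d) (x dW : 'cV[R]_d) : 'cV[R]_d :=
  x + h *: fl x + sl x *m dW.

(* As W_{t+h} - W_t is independent of the Euler process at time t, conditioning
   on that process being at x at time t amounts to making its step to t + h
   start from x. This is the only version of the conditional expectation that
   is defined at every x. *)
Definition cond_expect (R : realType) (d : nat) (dO : measure_display)
    (Omega : measurableType dO) (P : probability Omega R)
    (W : R -> Omega -> 'cV[R]_d) (h : R) (fl : 'cV[R]_d -> 'cV[R]_d)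
    (sl : 'cV[R]_d -> 'M[R]_d) (t : R) (x : 'cV[R]_d)
    (G : 'cV[R]_d -> 'cV[R]_d -> R) : R :=
  fine 'E_P[(fun w => let dW := W (t + h) w - W t w in
                      G (euler_step h fl sl x dW) dW)%R]%E.

Definition D0 (R : realType) (d : nat) (dO : measure_display)
    (Omega : measurableType dO) (P : probability Omega R)
    (W : R -> Omega -> 'cV[R]_d) (h : R) (fl : 'cV[R]_d -> 'cV[R]_d)
    (sl : 'cV[R]_d -> 'M[R]_d) (phi : R -> 'cV[R]_d -> R)
    (t : R) (x : 'cV[R]_d) : R :=
  cond_expect P W h fl sl t x (fun X _ => phi (t + h) X).

Definition D1 (R : realType) (d : nat) (dO : measure_display)
    (Omega : measurableType dO) (P : probability Omega R)
    (W : R -> Omega -> 'cV[R]_d) (h : R) (fl : 'cV[R]_d -> 'cV[R]_d)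
    (sl : 'cV[R]_d -> 'M[R]_d) (g : 'cV[R]_d) (r : R)
    (phi : R -> 'cV[R]_d -> R) (t : R) (x : 'cV[R]_d) : R :=
  cond_expect P W h fl sl t x
    (fun X dW => (phi (t + h) X - r) * poly1 g (h^-1 *: dW)).

Definition D2 (R : realType) (d l : nat) (dO : measure_display)
    (Omega : measurableType dO) (P : probability Omega R)
    (W : R -> Omega -> 'cV[R]_d) (h : R) (fl : 'cV[R]_d -> 'cV[R]_d)
    (sl : 'cV[R]_d -> 'M[R]_d) (Sig : 'M[R]_(d, l)) (k : nat)
    (phi : R -> 'cV[R]_d -> R) (t : R) (x : 'cV[R]_d) : R :=
  h^-1 * cond_expect P W h fl sl t x
    (fun X dW => phi (t + h) X * poly2 Sig k ((Num.sqrt h)^-1 *: dW)).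

Definition scheme_set (R : realType) (M : finType) (d p l k : nat)
    (dO : measure_display) (Omega : measurableType dO)
    (P : probability Omega R) (W : R -> Omega -> 'cV[R]_d)
    (U : set 'cV[R]_p)
    (delta ell : M -> 'cV[R]_d -> 'cV[R]_p -> R)
    (fl : M -> 'cV[R]_d -> 'cV[R]_d) (sl : M -> 'cV[R]_d -> 'M[R]_d)
    (g : M -> 'cV[R]_d -> 'cV[R]_p -> 'cV[R]_d)
    (Sig : M -> 'cV[R]_d -> 'cV[R]_p -> 'M[R]_(d, l))
    (h t : R) (x : 'cV[R]_d) (r : R) (phi : R -> 'cV[R]_d -> R) : set R :=
  [set y | exists m u, U u /\
    y = h^-1 * (D0 P W h (fl m) (sl m) phi t x - r)
        + ell m x u - delta m x u * r
        + D1 P W h (fl m) (sl m) (g m x u) r phi t x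
        + D2 P W h (fl m) (sl m) (Sig m x u) k phi t x].

Definition scheme (R : realType) (M : finType) (d p l k : nat)
    (dO : measure_display) (Omega : measurableType dO)
    (P : probability Omega R) (W : R -> Omega -> 'cV[R]_d)
    (U : set 'cV[R]_p)
    (delta ell : M -> 'cV[R]_d -> 'cV[R]_p -> R)
    (fl : M -> 'cV[R]_d -> 'cV[R]_d) (sl : M -> 'cV[R]_d -> 'M[R]_d)
    (g : M -> 'cV[R]_d -> 'cV[R]_p -> 'cV[R]_d)
    (Sig : M -> 'cV[R]_d -> 'cV[R]_p -> 'M[R]_(d, l))
    (h t : R) (x : 'cV[R]_d) (r : R) (phi : R -> 'cV[R]_d -> R) : R :=
  - sup (scheme_set k P W U delta ell fl sl g Sig h t x r phi).

(* Derivatives are taken on [0, T] x R^d, hence one-sided in time at 0 and T.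
   [None] is the time direction, [Some i] the i-th space direction. *)

Definition time_quotient (R : realType) (d : nat) (phi : R -> 'cV[R]_d -> R)
    (t : R) (x : 'cV[R]_d) (s : R) : R :=
  (s - t)^-1 * (phi s x - phi t x).

Definition pderiv1 (R : realType) (d : nat) (T : R) (a : option 'I_d)
    (phi : R -> 'cV[R]_d -> R) (t : R) (x : 'cV[R]_d) : R :=
  if a is Some i then 'D_(delta_mx i 0) (phi t) x
  else lim (time_quotient phi t x @ within `[0, T] t^').

Definition pderivable1 (R : realType) (d : nat) (T : R) (a : option 'I_d)
    (phi : R -> 'cV[R]_d -> R) (t : R) (x : 'cV[R]_d) : Prop :=
  if a is Some i then derivable (phi t) x (delta_mx i 0)
  else cvg (time_quotient phi t x @ within `[0, T] t^').

(* The derivative for the head of [s] is taken last. *)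
Definition pderiv (R : realType) (d : nat) (T : R) (s : seq (option 'I_d))
    (phi : R -> 'cV[R]_d -> R) : R -> 'cV[R]_d -> R :=
  foldr (pderiv1 T) phi s.

Definition smooth_bounded (R : realType) (d : nat) (T : R)
    (v : R -> 'cV[R]_d -> R) : Prop :=
  forall s : seq (option 'I_d),
    [/\ forall a t x, 0 <= t <= T -> pderivable1 T a (pderiv T s v) t x,
        {within [set z : R * 'cV[R]_d | 0 <= z.1 <= T],
          continuous (fun z : R * 'cV[R]_d => pderiv T s v z.1 z.2)}
      & exists B : R, forall t x, 0 <= t <= T -> `|pderiv T s v t x| <= B].

(* p derivatives in t and, for each i, beta i derivatives in x_i. *)
Definition mixed_index (d p : nat) (beta : 'I_d -> nat) : seq (option 'I_d) :=
  nseq p None ++ flatten [seq nseq (beta i) (Some i) | i <- enum 'I_d].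

Definition deriv_seminorm (R : realType) (d : nat) (T : R)
    (v : R -> 'cV[R]_d -> R) (p q : nat) : R :=
  sup [set y | exists t x (beta : 'I_d -> nat),
    [/\ 0 <= t <= T, (\sum_i beta i)%N = q
      & y = `|pderiv T (mixed_index p beta) v t x|]].

Definition time_deriv (R : realType) (d : nat) (T : R)
    (v : R -> 'cV[R]_d -> R) : R -> 'cV[R]_d -> R := pderiv T [:: None] v.

Definition gradient (R : realType) (d : nat) (T : R)
    (v : R -> 'cV[R]_d -> R) (t : R) (x : 'cV[R]_d) : 'cV[R]_d :=
  \col_i pderiv T [:: Some i] v t x.

Definition hessian (R : realType) (d : nat) (T : R)
    (v : R -> 'cV[R]_d -> R) (t : R) (x : 'cV[R]_d) : 'M[R]_d :=
  \matrix_(i, j) pderiv T [:: Some i; Some j] v t x.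

Definition error_bound (R : realType) (K Kt h eps : R) : R :=
  K * Kt *
    (h * eps ^- 3 * (1 + Num.sqrt h) ^+ 4 * (1 + Num.sqrt h * eps^-1) ^+ 4
     + Num.sqrt h * eps^-1 * (1 + Num.sqrt h) ^+ 2
         * (1 + Num.sqrt h * eps^-1) ^+ 2).

(* Main.v *)
Require Import Defs.
From HB Require Import structures.
From mathcomp Require Import all_boot all_order all_algebra.
From mathcomp Require Import all_classical all_reals all_analysis.
From mathcomp Require Import measurable_realfun ring lra.

Set Implicit Arguments.
Unset Strict Implicit.
Unset Printing Implicit Defensive.

Import Order.TTheory GRing.Theory Num.Theory.
Import numFieldNormedType.Exports.
Import HBNNSimple.

Local Open Scope classical_set_scope.
Local Open Scope ring_scope.

(** The scheme and the Hamiltonian are suprema over the same controls, so it is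
enough to compare, for one control, the bracket of the scheme with the bracket
of the Hamiltonian plus the time derivative: attained suprema of families that
are pairwise within E differ by at most E ([sup_dist_le]).

Fix a control. Write S = sl x, a = fl x, and let N = W (t + h) - W t be the
increment, a centred Gaussian vector with covariance h I. The decomposition
gives sigma sigma^T = S S^T + S Sig Sig^T S^T and f = a + S g, and each of the
three operators of the scheme accounts for one part:
- D0 for the time derivative, a . Dv and the trace of S S^T D^2 v;
- D1 for (S g) . Dv;
- D2 for the trace of S Sig Sig^T S^T D^2 v.

D0 and D2 are both expectations of v (t + h, x + h a + S N) P(N) with P an even
function, P = 1 or P = poly2. Averaging over N and - N removes the odd orders
of the Taylor expansion, so that the remainder after the second order is
bounded by the fourth derivatives times |N|^4, that is by h^2 eps^-3. The
second order term is h / 2 times the trace of S M S^T D^2 v, where M is defined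
by E[N N^T P(N)] = h M ([weighted_generator_le]). For P = 1 this is the identity;
for P = poly2 it is Sig Sig^T, and moreover E[P(N)] = 0: the coefficients c_k
and d_k are chosen for these two identities, which follow from Gaussian
integration by parts ([Ex_poly2], [Ex_coord2_poly2]).

For D1, poly1 g w is g . w plus the even function sum_i |g_i| |w_i| ([poly1E]),
so the linear part of the increment of v only sees g . w and
E[N poly1 g (N / h)] = g. What is left of the increment, namely the variation in
time, the drift part h a . Dv and the Taylor remainder of order 2, is multiplied
by a weight of size |N| / h, which leaves an error of order sqrt h / eps
([poly1_consistency_le]).

The smoothness hypothesis says that a derivative of order a in time and b in
space, with 2 a + b = n + 1, is at most Kt eps^-n. Since eps <= 1, up to constants
the errors of D0 and D2 are at most h Kt eps^-3 after division by h, and that of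
D1 is at most sqrt h (1 + h) Kt / eps. The remaining factors of the bound are at
least 1, and 1 + h <= (1 + sqrt h)^2 ([error_bound_le]).

The Taylor estimates only use the mean value theorem along lines; mixed
derivatives are reordered by the theorem of Schwarz, because the seminorms only
see derivatives in a fixed order. *)

(** * Moments of the normal law on the line *)

Section normal1d.
Context {R : realType}.
Implicit Types s x : R.
Local Notation leb := (@lebesgue_measure R).

(** [normal_pdf] is the density of the law with respect to Lebesgue measure. True
by definition for indicators, hence for simple functions, hence in the limit by
monotone convergence. *)
Lemma ge0_integral_normal_prob (m s : R) (f : R -> \bar R) :
  measurable_fun [set: R] f -> (forall x, (0 <= f x)%E) ->
  (\int[normal_prob m s]_x f x = \int[leb]_x (f x * (normal_pdf m s x)%:E))%E.
Proof.
move=> mf f0.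
have mp : measurable_fun [set: R] (EFin \o normal_pdf m s).
  by apply/measurable_EFinP; exact: measurable_normal_pdf.
pose g := nnsfun_approx measurableT mf.
have nd x a b : (a <= b)%N -> g a x <= g b x.
  by move=> ab; have /lefP := nd_nnsfun_approx measurableT mf ab; exact.
have mg n : measurable_fun [set: R] (EFin \o g n).
  by apply/measurable_EFinP; exact: measurable_funPT.
have gf x : (EFin \o g n) x @[n --> \oo] --> f x by exact: cvg_nnsfun_approx.
transitivity (limn (fun n => \int[normal_prob m s]_x (EFin \o g n) x))%E.
  rewrite -monotone_convergence//=.
  - by apply: eq_integral => x _; apply/esym/cvg_lim => //; exact: gf.
  - by move=> n x _; rewrite lee_fin.
  - by move=> x _ a b ab; rewrite lee_fin; exact: nd.
transitivity (limn (fun n => \int[leb]_x ((EFin \o g n) x * (normal_pdf m s x)%:E)))%E; last first.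
  rewrite -monotone_convergence//=.
  - apply: eq_integral => x _; apply/cvg_lim => //.
    by apply: cvgeZr => //; exact: gf.
  - by move=> n; apply: emeasurable_funM => //; exact: mg.
  - by move=> n x _; rewrite mule_ge0// lee_fin// normal_pdf_ge0.
  - move=> x _ a b ab; rewrite lee_wpmul2r ?lee_fin ?normal_pdf_ge0//.
    exact: nd.
congr (limn _); apply/funext => n.
have mE r : measurable (g n @^-1` [set r] : set R) by exact: measurable_funPTI.
have mI r : measurable_fun [set: R] (fun x => (r * \1_(g n @^-1` [set r]) x)%:E : \bar R).
  by apply/measurable_EFinP; apply: measurable_funM => //; exact: measurable_indic.
under eq_integral do rewrite /= fimfunE -fsumEFin//.
rewrite ge0_integral_fsum//; last by move=> y x _; exact: nnfun_muleindic_ge0.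
under [RHS]eq_integral => x _.
  rewrite /= fimfunE -fsumEFin//.
  rewrite ge0_mule_fsuml; last by move=> y; exact: nnfun_muleindic_ge0.
  over.
rewrite ge0_integral_fsum//; last 2 first.
  - move=> y; apply: emeasurable_funM => //; exact: mI.
  - move=> y x _; rewrite mule_ge0 ?lee_fin ?normal_pdf_ge0//.
    exact: nnfun_muleindic_ge0.
apply: eq_fsbigr => r _.
have [r0|r0] := leP 0 r; last first.
  rewrite preimage_nnfun0// !integral0_eq//.
    by move=> x _; rewrite indic0 mulr0 mul0e.
  by move=> x _; rewrite indic0 mulr0.
have mI1 : measurable_fun [set: R] (fun x => (\1_(g n @^-1` [set r]) x)%:E : \bar R).
  by apply/measurable_EFinP; exact: measurable_indic.
under eq_integral do rewrite EFinM.
under [RHS]eq_integral do rewrite EFinM -muleA.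
rewrite ge0_integralZl//=.
rewrite ge0_integralZl//=; last 2 first.
  - exact: emeasurable_funM.
  - by move=> x _; rewrite mule_ge0 ?lee_fin ?normal_pdf_ge0.
congr (_ * _)%E; rewrite integral_indic ?setIT//; last exact: mE.
transitivity (\int[leb]_(x in g n @^-1` [set r]) (normal_pdf m s x)%:E)%E; first by [].
rewrite integral_mkcond; apply: eq_integral => x _.
rewrite /= patchE indicE; case: ifPn => xE; rewrite ?mul1e ?mul0e//.
Qed.

(** 1 + y <= e^y at y = x / n, raised to the power n. *)
Lemma pow_le_expR n x : 0 <= x -> x ^+ n <= n%:R ^+ n * expR x.
Proof.
case: n => [|n] x0; first by rewrite !expr0 mul1r -expR0 ler_expR.
have n0 : (0 : R) < n.+1%:R by [].
have {1}-> : x = n.+1%:R * (x / n.+1%:R) by rewrite mulrC divfK ?gt_eqF.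
have -> : expR x = expR (x / n.+1%:R) ^+ n.+1.
  by rewrite -expRM_natl -mulr_natl mulrC divfK ?gt_eqF.
rewrite exprMn ler_pM2l ?exprn_gt0// lerXn2r ?nnegrE ?divr_ge0 ?expR_ge0//.
by rewrite (le_trans _ (expR_ge1Dx _))// lerDr.
Qed.

(** Doubling the standard deviation leaves a factor exp (- 3 x^2 / (8 s^2)) to
absorb any power of x. This reduces the integrability of functions of
polynomial growth to that of a density. *)
Lemma normal_pdf_pow_le n s : 0 < s -> exists2 C, 0 <= C &
  forall x, `|x| ^+ n * normal_pdf 0 s x <= C * normal_pdf 0 (2 * s) x.
Proof.
move=> s0.
have s20 : 2 * s != 0 by rewrite mulf_neq0// gt_eqF.
(* q compensates the normalising constants; c bounds x^(2n) exp (- x^2 / (4 s^2)) *)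
pose q := normal_peak s / normal_peak (2 * s).
have q0 : 0 <= q by rewrite divr_ge0 ?normal_peak_ge0.
pose c := (4 * s ^+ 2) ^+ n * n%:R ^+ n.
have c0 : 0 <= c by rewrite mulr_ge0 ?exprn_ge0// mulr_ge0// sqr_ge0.
exists ((1 + c) * q).
  by rewrite mulr_ge0// addr_ge0.
move=> x; rewrite !normal_pdfE ?(gt_eqF s0)//.
rewrite /normal_fun !subr0.
have -> : (1 + c) * q * (normal_peak (2 * s) * expR (- x ^+ 2 / ((2 * s) ^+ 2 *+ 2))) =
  normal_peak s * ((1 + c) * expR (- x ^+ 2 / ((2 * s) ^+ 2 *+ 2))).
  rewrite /q; field; by rewrite gt_eqF// normal_peak_gt0.
rewrite mulrCA ler_wpM2l ?normal_peak_ge0//.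
pose y := x ^+ 2 / (4 * s ^+ 2).
have s40 : 0 < 4 * s ^+ 2 by rewrite mulr_gt0// exprn_gt0.
have y0 : 0 <= y by rewrite divr_ge0 ?sqr_ge0 ?ltW.
have xn : `|x| ^+ n <= 1 + (x ^+ 2) ^+ n.
  have -> : (x ^+ 2) ^+ n = (`|x| ^+ n) ^+ 2.
    by rewrite -[x ^+ 2]real_normK ?num_real// -!exprM mulnC.
  have := sqr_ge0 (`|x| ^+ n - 1); have := exprn_ge0 n (normr_ge0 x); nra.
have -> : - x ^+ 2 / (s ^+ 2 *+ 2) = - (y *+ 2).
  by rewrite /y; field; rewrite gt_eqF.
have -> : - x ^+ 2 / ((2 * s) ^+ 2 *+ 2) = - (y / 2).
  by rewrite /y; field; rewrite gt_eqF.
rewrite (@le_trans _ _ ((1 + c) * expR y * expR (- (y *+ 2))))//.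
  rewrite ler_wpM2r ?expR_ge0// (le_trans xn)// mulrDl mul1r lerD//.
    by rewrite -expR0 ler_expR.
  have -> : (x ^+ 2) ^+ n = (4 * s ^+ 2) ^+ n * y ^+ n.
    by rewrite -exprMn /y mulrC divfK ?gt_eqF.
  by rewrite /c -mulrA ler_wpM2l ?exprn_ge0 ?(ltW s40)// pow_le_expR.
rewrite -mulrA -expRD ler_wpM2l ?addr_ge0// ler_expR; lra.
Qed.

Lemma horner_le_pow (p : {poly R}) : exists2 C, 0 <= C &
  forall x, `|p.[x]| <= C * (1 + `|x| ^+ (size p)).
Proof.
exists (\sum_(i < size p) `|p`_i|); first exact: sumr_ge0.
move=> x; rewrite horner_coef (le_trans (ler_norm_sum _ _ _))//.
rewrite mulr_suml; apply: ler_sum => i _.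
rewrite normrM normrX ler_wpM2l//.
have [x1|x1] := leP `|x| 1.
  by rewrite (@le_trans _ _ 1) ?exprn_ile1// lerDl exprn_ge0.
by rewrite (@le_trans _ _ (`|x| ^+ size p)) ?lerDr// ler_eXn2l// ltnW.
Qed.

Lemma integrable_normal_prob_le s (f : R -> R) n C : 0 < s ->
  measurable_fun [set: R] f -> (forall x, `|f x| <= C * (1 + `|x| ^+ n)) ->
  (leb.-integrable setT (fun x => (f x * normal_pdf 0 s x)%:E) *
  (normal_prob 0 s).-integrable setT (EFin \o f))%type.
Proof.
move=> s0 mf fC.
have [c0 c00 hc0] := normal_pdf_pow_le 0 s0.
have [c1 c10 hc1] := normal_pdf_pow_le n s0.
have C0 : 0 <= C.
  have := le_trans (normr_ge0 _) (fC 0).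
  by rewrite pmulr_lge0// ltr_pwDl// exprn_ge0.
have mfp : measurable_fun [set: R] (fun x => (f x * normal_pdf 0 s x)%:E : \bar R).
  by apply/measurable_EFinP; apply: measurable_funM => //; exact: measurable_normal_pdf.
have H : leb.-integrable setT (fun x => (f x * normal_pdf 0 s x)%:E).
  have Hd : leb.-integrable [set: R] (fun x => (C * (c0 + c1))%:E * (normal_pdf 0 (2 * s) x)%:E)%E.
    by apply: integrableZl => //; exact: integrable_normal_pdf.
  apply: (@le_integrable _ _ R leb [set: R] measurableT _ _ mfp _ Hd).
    move=> x _; rewrite -EFinM !abse_EFin lee_fin.
    rewrite [leRHS]ger0_norm; last by rewrite !mulr_ge0 ?addr_ge0 ?normal_pdf_ge0.
    rewrite normrM [X in _ * X]ger0_norm ?normal_pdf_ge0//.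
    rewrite (le_trans (ler_wpM2r (normal_pdf_ge0 _ _ _) (fC x)))//.
    rewrite -!mulrA ler_wpM2l// mulrDl [in leRHS]mulrDl lerD//.
    by have := hc0 x; rewrite expr0.
split => //.
apply/integrableP; split; first exact/measurable_EFinP.
rewrite ge0_integral_normal_prob//; last first.
  by do 2 apply: measurableT_comp => //.
move/integrableP : H => [_]; apply: le_lt_trans.
apply: ge0_le_integral => //.
- by move=> x _; rewrite mule_ge0// lee_fin normal_pdf_ge0.
- apply: emeasurable_funM; first by do 2 apply: measurableT_comp => //.
  by apply/measurable_EFinP; exact: measurable_normal_pdf.
- exact: measurableT_comp mfp.
- by move=> x _; rewrite EFinM abseM (@gee0_abs _ (normal_pdf 0 s x)%:E) ?lee_fin ?normal_pdf_ge0.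
Qed.

Lemma integral_normal_probE s (f : R -> R) n C : 0 < s ->
  measurable_fun [set: R] f -> (forall x, `|f x| <= C * (1 + `|x| ^+ n)) ->
  (\int[normal_prob 0 s]_x (f x)%:E = \int[leb]_x (f x * normal_pdf 0 s x)%:E)%E.
Proof.
move=> s0 mf fC.
have [H1 H2] := integrable_normal_prob_le s0 mf fC.
rewrite [LHS]integralE [RHS]integralE.
rewrite ge0_integral_normal_prob//; last first.
  by apply: measurable_funepos; exact/measurable_EFinP.
rewrite ge0_integral_normal_prob//; last first.
  by apply: measurable_funeneg; exact/measurable_EFinP.
congr (_ - _)%E; apply: eq_integral => x _.
- rewrite !funeposE -!EFin_max -EFinM maxr_pMl ?mul0r//.
  exact: normal_pdf_ge0.
- rewrite !funenegE -!EFin_max -EFinM maxr_pMl ?mul0r ?mulNr//.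
  exact: normal_pdf_ge0.
Qed.

Lemma horner_pdf_bounded s (p : {poly R}) : 0 < s ->
  exists B, forall x, `|p.[x]| * normal_pdf 0 s x <= B.
Proof.
move=> s0.
have [C C0 pC] := horner_le_pow p.
have [c0 c00 hc0] := normal_pdf_pow_le 0 s0.
have [c1 c10 hc1] := normal_pdf_pow_le (size p) s0.
exists (C * ((c0 + c1) * normal_peak (2 * s))) => x.
rewrite (le_trans (ler_wpM2r (normal_pdf_ge0 _ _ _) (pC x)))//.
rewrite -mulrA ler_wpM2l// (@le_trans _ _ ((c0 + c1) * normal_pdf 0 (2 * s) x))//.
  by rewrite mulrDl [in leRHS]mulrDl lerD//; have := hc0 x; rewrite expr0.
rewrite ler_wpM2l ?addr_ge0// normal_pdf_ub// mulf_neq0 ?gt_eqF//.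
Qed.

Lemma is_derive_normal_pdf s x : s != 0 ->
  is_derive x 1 (normal_pdf 0 s) (- (x / s ^+ 2) * normal_pdf 0 s x).
Proof.
move=> s0; rewrite normal_pdfE//.
have -> : (fun m0 s0 x : R => normal_peak s0 * normal_fun m0 s0 x) 0 s =
  normal_peak s \*: (expR \o ((- (s ^+ 2 *+ 2)^-1) \*: (@GRing.exp R ^~ 2))).
  apply/funext => y /=; rewrite /normal_fun subr0; congr (_ * expR _).
  by rewrite /GRing.scale/= !mulNr mulrC.
have D : is_derive x 1 ((- (s ^+ 2 *+ 2)^-1) \*: (@GRing.exp R ^~ 2)) (- (x / s ^+ 2)).
  by apply: is_derive_eq; rewrite /GRing.scale/=; field.
have D2 := is_derive1_comp (is_derive_expR _) D.
apply: is_derive_eq; rewrite /GRing.scale_fun /GRing.scale/= [RHS]mulrC -mulrA.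
congr (_ * (expR _ * _)); rewrite subr0 !mulNr mulrC //.
Qed.

(** Integration by parts: the integrand times the density is the derivative of
- s^2 p(x) times the density, which vanishes at infinity. *)
Lemma integral_normal_prob_stein s (p : {poly R}) : 0 < s ->
  (\int[normal_prob 0 s]_x (x * p.[x] - s ^+ 2 * p^`().[x])%:E = 0)%E.
Proof.
move=> s0; have sn0 : s != 0 by rewrite gt_eqF.
pose q := 'X * p - s ^+ 2 *: p^`().
under eq_integral => x _.
  have -> : x * p.[x] - s ^+ 2 * p^`().[x] = q.[x] by rewrite /q !hornerE.
  over.
have [Cq Cq0 hq] := horner_le_pow q.
have mq : measurable_fun [set: R] (horner q).
  by apply: continuous_measurable_fun; exact: continuous_horner.
rewrite (integral_normal_probE s0 mq hq).
have [iq _] := integrable_normal_prob_le s0 mq hq.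
pose f x : \bar R := (q.[x] * normal_pdf 0 s x)%:E.
(* a primitive of f, used on the intervals [- n, n] *)
pose G x := - s ^+ 2 * (p.[x] * normal_pdf 0 s x).
have dG x : is_derive x 1 G (q.[x] * normal_pdf 0 s x).
  have dp := is_derive_normal_pdf x sn0.
  have := is_deriveZ (- s ^+ 2) (is_deriveM (is_derive_poly p x) dp).
  move=> H; apply: (@is_derive_eq _ _ _ _ _ _ _ _ H).
  by rewrite /q !hornerE /GRing.scale/=; field.
have FTC n : (\int[leb]_(x in `[(- n.+1%:R : R)%R, (n.+1%:R : R)%R]) f x = (G n.+1%:R - G (- n.+1%:R))%:E)%E.
  rewrite EFinB; apply: (@continuous_FTC2 R (fun x => q.[x] * normal_pdf 0 s x)).
  - by rewrite -subr_gt0 opprK addr_gt0.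
  - apply: continuous_subspaceT => x; apply: cvgM; first exact: continuous_horner.
    exact: continuous_normal_pdf.
  - have cG x : {for x, continuous G}.
      by apply/differentiable_continuous/derivable1_diffP; case: (dG x).
    split.
    + by move=> x _; case: (dG x).
    + by apply: cvg_at_right_filter; exact: cG.
    + by apply: cvg_at_left_filter; exact: cG.
  - by move=> x _; rewrite derive1E; case: (dG x).
have [B hB] := horner_pdf_bounded ('X * p) s0.
have GB x : 0 < `|x| -> `|G x| <= s ^+ 2 * B / `|x|.
  move=> x0; rewrite ler_pdivlMr// /G normrM normrN.
  have := hB x; rewrite !hornerE !normrM (ger0_norm (normal_pdf_ge0 _ _ _)).
  rewrite (gtr0_norm s0) -expr2 => hBx; rewrite -[leLHS]mulrA ler_wpM2l ?sqr_ge0//.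
  by rewrite mulrC mulrA.
have lim1 : (\int[leb]_(x in `[(- n.+1%:R : R)%R, (n.+1%:R : R)%R]) f x)%E @[n --> \oo] --> 0%E.
  under eq_fun do rewrite FTC.
  apply/fine_cvgP; split; first exact: nearW.
  have Gb n : `|G n.+1%:R - G (- n.+1%:R)| <= (s ^+ 2 * B) *+ 2 * harmonic n.
    rewrite (le_trans (ler_normB _ _))// mulr2n mulrDl lerD//.
      by have := GB n.+1%:R; rewrite normr_nat; exact.
    by have := GB (- n.+1%:R); rewrite normrN normr_nat; exact.
  apply: norm_cvg0.
  apply: (@squeeze_cvgr _ _ _ _ (cst 0) (fun n => (s ^+ 2 * B) *+ 2 * harmonic n)).
  - by apply: nearW => n; rewrite normr_ge0/= Gb.
  - exact: cvg_cst.
  - by rewrite -[X in _ --> X](mulr0 ((s ^+ 2 * B) *+ 2)); apply: cvgMr; exact: cvg_harmonic.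
pose fn (n : nat) : R -> \bar R := f \_ `[(- n.+1%:R : R)%R, (n.+1%:R : R)%R]%classic.
have mf : measurable_fun [set: R] f.
  apply/measurable_EFinP; apply: measurable_funM => //.
  exact: measurable_normal_pdf.
have mfn n : measurable_fun [set: R] (fn n).
  have mD : measurable (`[(- n.+1%:R : R)%R, (n.+1%:R : R)%R]%classic : set R) by exact: measurable_itv.
  have [+ _] := measurable_restrictT f mD; apply.
  by apply: (@measurable_funS _ _ _ _ setT) => //; exact: mf.
have lim2 : (\int[leb]_x fn n x)%E @[n --> \oo] --> (\int[leb]_x f x)%E.
  apply: (@dominated_cvg _ _ _ leb setT measurableT fn f (fun x => `|f x|%E)) => //.
  - move=> x _; apply: cvg_near_cst; near=> n.
    rewrite /fn patchE ifT// inE/= in_itv/= -ler_norml.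
    have : `|x| <= n%:R by near: n; exact: nbhs_infty_ger.
    by move=> /le_trans; apply; rewrite ler_nat.
  - exact: integrable_abse iq.
  - by move=> n x _; rewrite /fn patchE; case: ifPn => // _; rewrite abse0.
rewrite -(cvg_lim _ lim2)//; apply/cvg_lim => //.
by under eq_fun do rewrite /fn -integral_mkcond.
Unshelve. all: end_near. Qed.

Lemma normal_probN s (A : set R) : s != 0 -> measurable A ->
  normal_prob 0 s (-%R @^-1` A) = normal_prob 0 s A.
Proof.
move=> s0 mA; rewrite /normal_prob.
have mp : measurable_fun [set: R] (EFin \o normal_pdf 0 s).
  by apply/measurable_EFinP; exact: measurable_normal_pdf.
under eq_integral => x _.
  have -> : normal_pdf 0 s x = normal_pdf 0 s (- x).
    by rewrite normal_pdfE// /normal_fun !subr0 sqrrN.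
  over.
have mN : measurable_fun (setT : set (measurableTypeR R)) (-%R : measurableTypeR R -> measurableTypeR R).
  exact: oppr_measurable.
have -> : (\int[leb]_(x in -%R @^-1` A) ((fun x => (normal_pdf 0 s (- x))%:E) x) =
  \int[pushforward leb (-%R : _ -> measurableTypeR R)]_(x in A) (normal_pdf 0 s x)%:E)%E.
  rewrite ge0_integral_pushforward//.
    exact: measurable_funTS.
  by move=> x _; rewrite lee_fin normal_pdf_ge0.
by apply: eq_measure_integral => //= B mB BA; rewrite lebesgue_measureN.
Qed.

Lemma normal_prob_horner s (p : {poly R}) : 0 < s ->
  (normal_prob 0 s).-integrable [set: R] (EFin \o horner p).
Proof.
move=> s0; have [C C0 hp] := horner_le_pow p.
have mp : measurable_fun [set: R] (horner p).
  by apply: continuous_measurable_fun; exact: continuous_horner.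
by have [_] := integrable_normal_prob_le s0 mp hp.
Qed.

Lemma normal_moment0 : normal_moment R 0 = 1.
Proof.
rewrite /normal_moment unlock.
under eq_integral do rewrite expr0.
rewrite (integral_cst (normal_prob 0 1) measurableT 1) mul1e.
exact: (congr1 fine (probability_setT (normal_prob (0 : R) 1))).
Qed.

(** The integration by parts formula for the polynomial X^(n+1). *)
Lemma normal_momentSS n : normal_moment R n.+2 = n.+1%:R * normal_moment R n.
Proof.
(* moments as integrals of polynomials, to which the integration by parts applies *)
have E m : normal_moment R m = fine (\int[normal_prob 0 1]_x ('X^m).[x]%:E)%E.
  by rewrite /normal_moment unlock; under [in RHS]eq_integral do rewrite hornerXn.
have i1 m := normal_prob_horner 'X^m (ltr01 : (0 : R) < 1).
have := integral_normal_prob_stein 'X^(n.+1) (ltr01 : (0 : R) < 1).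
under eq_integral => x _.
  have -> : x * ('X^(n.+1)).[x] - 1 ^+ 2 * ('X^(n.+1))^`().[x] = ('X^(n.+2)).[x] - (n.+1%:R *: 'X^n).[x].
    by rewrite derivXn !hornerE expr1n mul1r -exprS hornerMn hornerXn mulr_natl.
  rewrite EFinB; over.
rewrite integralB//; last 2 first.
  exact: i1.
  exact: normal_prob_horner.
rewrite !E.
have -> : (\int[normal_prob 0 1]_x (n.+1%:R *: ('X^n : {poly R})).[x]%:E = n.+1%:R%:E *
  \int[normal_prob 0 1]_x ('X^n : {poly R}).[x]%:E)%E.
  rewrite -(integralZl measurableT (i1 n)).
  by apply: eq_integral => x _; rewrite hornerZ EFinM.
have f1 m : (\int[normal_prob 0 1]_x ('X^m : {poly R}).[x]%:E)%E \is a fin_num.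
  by apply: integrable_fin_num => //; exact: i1.
rewrite -(fineK (f1 n.+2)) -(fineK (f1 n)) -EFinM -EFinB => -[] /eqP.
by rewrite subr_eq0 => /eqP ->.
Qed.

Lemma normal_moment_even_gt0 n : 0 < normal_moment R (2 * n).
Proof.
elim: n => [|n IH]; first by rewrite muln0 normal_moment0.
by rewrite mulnS add2n normal_momentSS mulr_gt0.
Qed.

End normal1d.

(** * Laws on column vectors *)

Section gvec.
Context {R : realType} {d : nat}.

Definition box (A : 'I_d -> set R) : set 'cV[R]_d :=
  [set y | forall i, A i (y i 0)].

Definition boxes : set (set 'cV[R]_d) :=
  [set B | exists2 A : 'I_d -> set R, (forall i, measurable (A i)) & B = box A].

(** Column vectors with the sigma-algebra generated by the boxes: independence of
the coordinates of a vector prescribes its law on boxes, and this determines the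
law. *)
Definition gvec := g_sigma_algebraType boxes.
HB.instance Definition _ := Measurable.on gvec.

Lemma boxI A B : box A `&` box B = box (fun i => A i `&` B i).
Proof.
by apply/seteqP; split => [y [Ay By] i|y AB]; [split|split => i; have [] := AB i].
Qed.

Lemma boxes_setI : setI_closed boxes.
Proof.
move=> _ _ [A mA ->] [B mB ->]; rewrite boxI; exists (fun i => A i `&` B i) => // i.
exact: measurableI.
Qed.

Lemma measurable_box A : (forall i, measurable (A i)) -> measurable (box A : set gvec).
Proof. by move=> mA; apply: sub_sigma_algebra; exists A. Qed.

Lemma box_setT : box (fun=> setT) = setT.
Proof. by apply/seteqP; split. Qed.

Lemma measurable_coord i : measurable_fun (setT : set gvec) (fun y : gvec => (y : 'cV[R]_d) i 0).
Proof.
move=> _ A mA; rewrite setTI.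
have -> : (fun y : gvec => (y : 'cV[R]_d) i 0) @^-1` A = box (fun j => if j == i then A else setT).
  apply/seteqP; split => y /= => [Ay j|/(_ i)]; last by rewrite eqxx.
  by case: eqP => [->|].
by apply: measurable_box => j; case: ifP.
Qed.

Lemma measurable_gvec dT (T : measurableType dT) (X : T -> gvec) :
  (forall i, measurable_fun setT (fun w => (X w : 'cV[R]_d) i 0)) ->
  measurable_fun setT X.
Proof.
move=> mX; apply: (@measurability _ _ T gvec setT X boxes) => //.
move=> _ [_ [A mA ->]] <-; rewrite setTI.
have -> : X @^-1` box A = \bigcap_(i in [set: 'I_d]) ((fun w => (X w : 'cV[R]_d) i 0) @^-1` A i).
  by apply/seteqP; split => w /= Aw i //=; exact: Aw.
apply: fin_bigcap_measurable; first exact: finite_finset.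
by move=> i _; rewrite -[X in measurable X]setTI; exact: mX.
Qed.

(** An open set is the union of the boxes with rational centre and radius that it
contains. *)
Lemma open_measurable_gvec (O : set 'cV[R]_d) : open O -> measurable (O : set gvec).
Proof.
move=> oO.
pose b (q : 'cV[rat]_d * rat) : set 'cV[R]_d :=
  box (fun i => `]ratr (q.1 i 0) - ratr q.2, ratr (q.1 i 0) + ratr q.2[%classic).
have -> : O = \bigcup_q (if asbool (b q `<=` O) then b q else set0).
  apply/seteqP; split => [y Oy|y [q _]]; last by case: asboolP => // + by_; exact.
  have /nbhs_ballP[e /= e0 yeO] : nbhs y O by exact: open_nbhs_nbhs.
  have [r0 /itvP r0e] := rat_in_itvoo (divr_gt0 e0 (ltr0Sn R 1)).
  have qP i : exists q : rat, y i 0 - ratr r0 < ratr q < y i 0 + ratr r0.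
    have /rat_in_itvoo[q] : y i 0 - ratr r0 < y i 0 + ratr r0 :> R.
      by rewrite ltrD2l gtrN// r0e.
    by rewrite in_itv/= => qi; exists q.
  pose q : 'cV[rat]_d := \col_i xchoose (qP i).
  have qy i : y i 0 - ratr r0 < ratr (q i 0) < y i 0 + ratr r0.
    by rewrite mxE; exact: (xchooseP (qP i)).
  exists (q, r0) => //; rewrite asboolT.
    by move=> i /=; rewrite in_itv/=; have := qy i; lra.
  move=> z bz; apply: yeO; split => // i j; rewrite (ord1 j).
  have := bz i; rewrite /= in_itv/= => /andP[z1 z2].
  have /andP[y1 y2] := qy i.
  have r02 : ratr r0 < e / 2 by rewrite r0e.
  rewrite /ball/= ltr_norml; apply/andP; split; lra.
apply: countable_bigcupT_measurable => // q; case: ifP => // _.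
by apply: measurable_box => i; exact: measurable_itv.
Qed.

Lemma continuous_measurable_gvec (F : 'cV[R]_d -> R) : continuous F ->
  measurable_fun (setT : set gvec) (F : gvec -> R).
Proof.
move=> /continuousP cF.
apply: (@measurability _ _ gvec R setT F (@RGenOpens.G R)).
  exact: RGenOpens.measurableE.
move=> _ [_ [a [b ->]] <-]; rewrite setTI.
apply: open_measurable_gvec; apply: cF; exact: interval_open.
Qed.

(** Boxes are stable under intersection, so the uniqueness theorem for measures
on generated sigma-algebras applies. *)
Lemma gvec_measure_unique (m1 m2 : {measure set gvec -> \bar R}) :
  (m1 setT < +oo)%E ->
  (forall A, (forall i, measurable (A i)) -> m1 (box A) = m2 (box A)) ->
  forall B, measurable B -> m1 B = m2 B.
Proof.
move=> m1T m12 B mB.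
apply: (@measure_unique _ R gvec boxes (fun=> setT)) => //.
- exact: boxes_setI.
- by move=> _; exists (fun=> setT); rewrite ?box_setT.
- by apply/seteqP; split => // y _; exists 0%N.
- by move=> _ [A mA ->]; exact: m12.
Qed.

End gvec.

Arguments gvec : clear implicits.

Section transfer.
Context {R : realType} d1 d2 (T : measurableType d1) (T' : measurableType d2).
Variables (P : {measure set T -> \bar R}) (nu : {measure set T' -> \bar R}) (X : T -> T').
Hypothesis mX : measurable_fun setT X.
Hypothesis PX : forall B, measurable B -> P (X @^-1` B) = nu B.

Lemma integrable_transfer (F : T' -> R) : measurable_fun setT F ->
  nu.-integrable setT (EFin \o F) -> P.-integrable setT (EFin \o (F \o X)).
Proof.
move=> mF /integrableP[_ iF]; apply/integrableP; split.
  by apply/measurable_EFinP; exact: measurableT_comp.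
have E : (\int[P]_x `|(F (X x))%:E| = \int[nu]_x `|(F x)%:E|)%E.
  rewrite -(@eq_measure_integral _ _ R setT nu (pushforward P X)); last by move=> B mB _; exact: PX.
  rewrite (@ge0_integral_pushforward _ _ _ _ _ _ mX P setT (fun x => `|(F x)%:E|%E)) ?preimage_setT//.
  by do 2 apply: measurableT_comp => //.
by rewrite [X in (X < _)%E](_ : _ = \int[P]_x `|(F (X x))%:E|)%E// E.
Qed.

Lemma integral_transfer (F : T' -> R) : measurable_fun setT F ->
  P.-integrable setT (EFin \o (F \o X)) ->
  (\int[nu]_y (F y)%:E = \int[P]_x (F (X x))%:E)%E.
Proof.
move=> mF iF.
rewrite -(@eq_measure_integral _ _ R setT nu (pushforward P X)); last by move=> B mB _; exact: PX.
by rewrite integral_pushforward ?preimage_setT//; exact/measurable_EFinP.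
Qed.

End transfer.

(** Bound every term of the sum by the largest one. *)
Lemma expr_sum_le (R : realType) (d n : nat) (a : 'I_d -> R) : (forall i, 0 <= a i) ->
  (\sum_i a i) ^+ n.+1 <= d%:R ^+ n.+1 * \sum_i a i ^+ n.+1.
Proof.
case: d a => [|d] a a0; first by rewrite !big_ord0 expr0n mulr0.
have [/= i0 _ i0P] := @Order.TotalTheory.arg_maxP _ _ _ ord0 xpredT a isT.
rewrite (@le_trans _ _ ((d.+1%:R * a i0) ^+ n.+1))//.
  rewrite lerXn2r ?nnegrE ?sumr_ge0 ?mulr_ge0//.
  rewrite (le_trans (ler_sum _ (fun i _ => i0P i isT)))//.
  by rewrite sumr_const card_ord mulr_natl.
rewrite exprMn ler_wpM2l ?exprn_ge0// (bigD1 i0)//= lerDl sumr_ge0// => i _.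
by rewrite exprn_ge0.
Qed.

(** * Expectations under a Gaussian vector with independent coordinates *)

Section gauss_vector.
Context {R : realType} {d : nat}.
Variables (s : R) (mu : probability (gvec R d) R).
Hypothesis s0 : 0 < s.
Local Notation gam := (normal_prob 0 s).
Hypothesis muE : forall A : 'I_d -> set R, (forall i, measurable (A i)) ->
  mu (box A) = (\prod_i fine (gam (A i)))%:E.
Implicit Types (F G : 'cV[R]_d -> R) (a y : 'cV[R]_d).

Let gam_fin (A : set R) : measurable A -> gam A = (fine (gam A))%:E.
Proof. by move=> mA; rewrite fineK// fin_num_measure. Qed.

Let gamT : gam [set: R] = 1%E. Proof. exact: probability_setT. Qed.

(** Both sides agree on boxes, as the normal law on the line is symmetric. *)
Lemma gauss_oppE (B : set (gvec R d)) : measurable B ->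
  mu ((-%R : gvec R d -> gvec R d) @^-1` B) = mu B.
Proof.
have mN : measurable_fun setT (-%R : gvec R d -> gvec R d).
  apply: measurable_gvec => i.
  rewrite (_ : (fun w => _) = (fun w : gvec R d => - (w : 'cV[R]_d) i 0)).
    by apply: measurableT_comp; [exact: oppr_measurable|exact: measurable_coord].
  by apply/funext => w; rewrite !mxE.
move=> mB; rewrite -/(pushforward mu (-%R : gvec R d -> gvec R d) B).
apply: gvec_measure_unique => //.
  change (mu ((-%R : gvec R d -> gvec R d) @^-1` setT) < +oo)%E.
  by rewrite preimage_setT probability_setT ltry.
move=> A mA; change (mu ((-%R : gvec R d -> gvec R d) @^-1` box A) = mu (box A)).
have -> : (-%R : gvec R d -> gvec R d) @^-1` box A = box (fun i => -%R @^-1` (A i)).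
  by apply/seteqP; split => y /= Ay i; have := Ay i; rewrite !mxE.
rewrite !muE//; last first.
  by move=> i; rewrite -[X in measurable X]setTI; apply: oppr_measurable.
by congr EFin; apply: eq_bigr => i _; rewrite normal_probN ?gt_eqF.
Qed.

(** Resampling of coordinate i: under the product of [mu] with the normal law on
the line, the resampled vector has law [mu] again. Integrals against [mu] can
then be computed by integrating one coordinate first. *)
Definition set_coord (i : 'I_d) (yz : gvec R d * R) : gvec R d :=
  \col_j if j == i then yz.2 else (yz.1 : 'cV[R]_d) j 0.

Lemma measurable_set_coord i : measurable_fun setT (set_coord i).
Proof.
apply: measurable_gvec => j; rewrite /set_coord.
have [->|ji] := eqVneq j i.
  rewrite (_ : (fun w => _) = snd); first exact: measurable_snd.
  by apply/funext => w; rewrite mxE eqxx.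
rewrite (_ : (fun w => _) = (fun y : gvec R d => (y : 'cV[R]_d) j 0) \o fst).
  by apply: measurableT_comp; [exact: measurable_coord|exact: measurable_fst].
by apply/funext => w; rewrite mxE (negbTE ji).
Qed.

Lemma gauss_set_coordE i (B : set (gvec R d)) : measurable B ->
  (mu \x gam)%E (set_coord i @^-1` B) = mu B.
Proof.
have mX := @measurable_set_coord i.
move=> mB; rewrite -/(pushforward (mu \x gam)%E (set_coord i) B).
apply: gvec_measure_unique => //.
  change ((mu \x gam)%E (set_coord i @^-1` setT) < +oo)%E.
  rewrite preimage_setT -setXTT product_measure1E//.
  apply: (@le_lt_trans _ _ 1%E); last exact: ltry.
  by rewrite -[leRHS]mule1; apply: lee_pmul => //; exact: probability_le1.
move=> A mA; change ((mu \x gam)%E (set_coord i @^-1` box A) = mu (box A)).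
have -> : set_coord i @^-1` box A = box (fun j => if j == i then setT else A j) `*` A i.
  apply/seteqP; split => [[y z] /= Ay|[y z] /= [Ay Az] j]; last first.
    by rewrite mxE /=; case: eqP => [->//|/eqP ji]; have := Ay j; rewrite (negbTE ji).
  split=> [j|]; last by have := Ay i; rewrite mxE eqxx.
  by have := Ay j; rewrite mxE; case: eqP.
have mA' j : measurable (if j == i then setT else A j) by case: ifP.
rewrite product_measure1E; [|exact: measurable_box|exact: mA].
transitivity (mu (box (fun j => if j == i then setT else A j)) * gam (A i))%E; first by [].
rewrite muE// muE//.
transitivity ((\prod_j fine (gam (if j == i then setT else A j)))%R%:E * (fine (gam (A i)))%:E)%E.
  by congr (_ * _)%E; exact: gam_fin.
rewrite -EFinM; congr EFin.
rewrite [RHS](bigD1 i)//= (bigD1 i)//= eqxx gamT mul1r mulrC; congr (_ * _).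
by apply: eq_bigr => j /negbTE ->.
Qed.

Lemma gauss_coordE i (A : set R) : measurable A ->
  mu ((fun y : gvec R d => (y : 'cV[R]_d) i 0) @^-1` A) = gam A.
Proof.
move=> mA.
have -> : (fun y : gvec R d => (y : 'cV[R]_d) i 0) @^-1` A = box (fun j => if j == i then A else setT).
  apply/seteqP; split => y /= => [Ay j|/(_ i)]; last by rewrite eqxx.
  by case: eqP => [->|].
rewrite muE; last by move=> j; case: ifP.
rewrite (bigD1 i)//= eqxx big1; first by rewrite mulr1 -gam_fin.
by move=> j /negbTE ->; rewrite gamT.
Qed.

Definition l1 y : R := \sum_i `|y i 0|.

Lemma l1_ge0 y : 0 <= l1 y. Proof. exact: sumr_ge0. Qed.

(** Measurable functions of polynomial growth. They form an algebra and are
integrable against every Gaussian law, so that membership in this class is the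
only side condition when expectations are computed. *)
Definition tame F := measurable_fun (setT : set (gvec R d)) F /\
  exists C n, 0 <= C /\ forall y, `|F y| <= C * (1 + l1 y ^+ n).

Lemma integrable_coordX i n : mu.-integrable setT (fun y : gvec R d => (`|(y : 'cV[R]_d) i 0| ^+ n)%:E).
Proof.
have mf : measurable_fun [set: R] (fun z : R => `|z| ^+ n).
  by apply: measurable_funX; exact: normr_measurable.
have H (z : R) : `| `|z| ^+ n| <= 1 * (1 + `|z| ^+ n) :> R.
  by rewrite mul1r ger0_norm ?exprn_ge0// lerDr.
have [_ hi] := integrable_normal_prob_le s0 mf H.
exact: (@integrable_transfer R _ _ (gvec R d) (measurableTypeR R) mu gam _ (measurable_coord i)
  (@gauss_coordE i) _ mf hi).
Qed.

Lemma tame_integrable F : tame F -> mu.-integrable setT (EFin \o (F : gvec R d -> R)).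
Proof.
move=> [mF [C [n [C0 hF]]]].
pose g : gvec R d -> \bar R := fun y => (C%:E * (2%:E + (d%:R ^+ n)%:E * \sum_(i < d) (`|(y :
  'cV[R]_d) i 0| ^+ n)%:E))%E.
have ig : mu.-integrable setT g.
  apply: integrableZl => //; apply: integrableD => //.
    exact: finite_measure_integrable_cst.
  apply: integrableZl => //; apply: integrable_sum => // i _.
  exact: integrable_coordX.
apply: (le_integrable _ _ _ ig) => //; first exact/measurable_EFinP.
move=> y _.
have -> : g y = (C * (2 + d%:R ^+ n * \sum_(i < d) `|(y : 'cV[R]_d) i 0| ^+ n))%:E.
  by rewrite EFinM EFinD EFinM -sumEFin.
rewrite !abse_EFin lee_fin.
rewrite (le_trans (hF y))// (le_trans _ (ler_norm _))// ler_wpM2l//.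
rewrite -[2]/(1 + 1) -addrA lerD//.
case: n {hF g ig} => [|n]; first by rewrite expr0 lerDl mulr_ge0// sumr_ge0.
by rewrite (le_trans (@expr_sum_le _ _ _ _ _))// lerDr.
Qed.

Let powD (x : R) m n : 0 <= x -> x ^+ m <= 1 + x ^+ (m + n).
Proof.
move=> x0; have [x1|x1] := leP x 1.
  by rewrite (le_trans (exprn_ile1 _ x0 x1))// lerDl exprn_ge0.
by rewrite (@le_trans _ _ (x ^+ (m + n))) ?lerDr// ler_eXn2l// leq_addr.
Qed.

Lemma tame_cst (c : R) : tame (fun=> c).
Proof.
split; first exact: measurable_cst.
exists `|c|, 0%N; split=> // y; rewrite expr0.
by rewrite ler_peMr// lerDl.
Qed.

Lemma tameD F G : tame F -> tame G -> tame (fun y => F y + G y).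
Proof.
move=> [mF [C [n [C0 hF]]]] [mG [C' [n' [C0' hG]]]]; split; first exact: measurable_funD.
exists (2 * (C + C')), (n + n')%N; split=> [|y]; first by rewrite mulr_ge0// addr_ge0.
rewrite (le_trans (ler_normD _ _))//.
have l0 := l1_ge0 y.
have h1 := powD n n' l0; have h2 := powD n' n l0; rewrite addnC in h2.
have h3 := exprn_ge0 (n + n') l0.
have e1 : C * (1 + l1 y ^+ n) <= C * (2 * (1 + l1 y ^+ (n + n'))) by rewrite ler_wpM2l//; lra.
have e2 : C' * (1 + l1 y ^+ n') <= C' * (2 * (1 + l1 y ^+ (n + n'))) by rewrite ler_wpM2l//; lra.
by have := hF y; have := hG y; lra.
Qed.

Lemma tameM F G : tame F -> tame G -> tame (fun y => F y * G y).
Proof.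
move=> [mF [C [n [C0 hF]]]] [mG [C' [n' [C0' hG]]]]; split; first exact: measurable_funM.
exists (3 * (C * C')), (n + n')%N; split=> [|y]; first by rewrite mulr_ge0// mulr_ge0.
have l0 := l1_ge0 y.
have h1 := powD n n' l0; have h2 := powD n' n l0; rewrite addnC in h2.
have h3 := exprn_ge0 (n + n') l0.
rewrite normrM (le_trans (ler_pM _ _ (hF y) (hG y)))// mulrACA.
rewrite -[leRHS]mulrA [leRHS]mulrCA ler_wpM2l ?mulr_ge0//.
rewrite mulrDl mul1r mulrDr mulr1 -exprD; lra.
Qed.

Lemma tameZ (c : R) F : tame F -> tame (fun y => c * F y).
Proof. exact: tameM (tame_cst c). Qed.

Lemma tameB F G : tame F -> tame G -> tame (fun y => F y - G y).
Proof.
move=> tF tG; rewrite (_ : (fun y => _) = (fun y => F y + (-1) * G y)).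
  by apply: tameD => //; exact: tameZ.
by apply/funext => y; rewrite mulN1r.
Qed.

Lemma tameX F n : tame F -> tame (fun y => F y ^+ n).
Proof.
move=> tF; elim: n => [|n IH]; first by under eq_fun do rewrite expr0; exact: tame_cst.
by under eq_fun do rewrite exprS; exact: tameM.
Qed.

Lemma tame_sum (I : Type) (r : seq I) (H : I -> 'cV[R]_d -> R) :
  (forall i, tame (H i)) -> tame (fun y => \sum_(i <- r) H i y).
Proof.
move=> tH; elim: r => [|i r IH].
  by under eq_fun do rewrite big_nil; exact: tame_cst.
by under eq_fun do rewrite big_cons; exact: tameD.
Qed.

Lemma tame_coord i : tame (fun y => y i 0).
Proof.
split; first exact: measurable_coord.
exists 1, 1%N; split=> // y; rewrite mul1r expr1.
by rewrite (@le_trans _ _ (l1 y)) ?lerDr// /l1 (bigD1 i)//= lerDl sumr_ge0.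
Qed.

Lemma tame_abs F : tame F -> tame (fun y => `|F y|).
Proof.
move=> [mF [C [n [C0 hF]]]]; split.
  by apply: measurableT_comp => //; exact: normr_measurable.
by exists C, n; split=> // y; rewrite normr_id.
Qed.

Lemma tame_l1 : tame l1.
Proof. by apply: tame_sum => i; apply: tame_abs; exact: tame_coord. Qed.

Lemma tame_dotp a : tame (dotp a).
Proof. by apply: tame_sum => i; apply: tameZ; exact: tame_coord. Qed.

Definition Ex F : R := \int[mu]_y F y.

Lemma Ex_cst c : Ex (fun=> c) = c.
Proof. rewrite /Ex Rintegral_cst// (_ : fine _ = 1) ?mulr1//.
exact: (congr1 fine (probability_setT mu)). Qed.

Lemma ExD F G : tame F -> tame G -> Ex (fun y => F y + G y) = Ex F + Ex G.
Proof. by move=> tF tG; rewrite /Ex RintegralD//; exact: tame_integrable. Qed.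

Lemma ExB F G : tame F -> tame G -> Ex (fun y => F y - G y) = Ex F - Ex G.
Proof. by move=> tF tG; rewrite /Ex RintegralB//; exact: tame_integrable. Qed.

Lemma ExZ c F : tame F -> Ex (fun y => c * F y) = c * Ex F.
Proof. by move=> tF; rewrite /Ex RintegralZl//; exact: tame_integrable. Qed.

Lemma Ex_sum (I : Type) (r : seq I) (H : I -> 'cV[R]_d -> R) :
  (forall i, tame (H i)) -> Ex (fun y => \sum_(i <- r) H i y) = \sum_(i <- r) Ex (H i).
Proof.
move=> tH; elim: r => [|i r IH].
  by rewrite big_nil; under eq_fun do rewrite big_nil; exact: Ex_cst.
rewrite big_cons -IH; under eq_fun do rewrite big_cons.
by rewrite ExD//; exact: tame_sum.
Qed.

Lemma le_Ex F G : tame F -> tame G -> (forall y, F y <= G y) -> Ex F <= Ex G.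
Proof. by move=> tF tG FG; apply: le_Rintegral => //; exact: tame_integrable. Qed.

Lemma Ex_norm_le F G : tame F -> tame G -> (forall y, `|F y| <= G y) -> `|Ex F| <= Ex G.
Proof.
move=> tF tG FG; rewrite (le_trans (le_normr_Rintegral _ _))//; first exact: tame_integrable.
by apply: le_Ex => //; exact: tame_abs.
Qed.

Lemma Ex_opp F : tame F -> Ex (fun y => F (- y)) = Ex F.
Proof.
move=> tF; have iF := tame_integrable tF; have [mF _] := tF.
have mN : measurable_fun setT (-%R : gvec R d -> gvec R d).
  apply: measurable_gvec => i.
  rewrite (_ : (fun w => _) = (fun w : gvec R d => - (w : 'cV[R]_d) i 0)).
    by apply: measurableT_comp; [exact: oppr_measurable|exact: measurable_coord].
  by apply/funext => w; rewrite !mxE.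
have iN := integrable_transfer mN gauss_oppE mF iF.
by rewrite /Ex /Rintegral (integral_transfer mN gauss_oppE mF iN).
Qed.

(** Resample coordinate i and apply Fubini's theorem, integrating first in that
coordinate. *)
Lemma Ex_set_coord0 i F : tame F ->
  (forall y : gvec R d, \int[gam]_z (F (set_coord i (y, z)))%:E = 0)%E -> Ex F = 0.
Proof.
move=> tF F0; have iF := tame_integrable tF; have [mF _] := tF.
have iX := @integrable_transfer R _ _ _ _ (mu \x gam)%E mu _ (@measurable_set_coord i)
  (@gauss_set_coordE i) _ mF iF.
rewrite /Ex /Rintegral (@integral_transfer R _ _ _ _ (mu \x gam)%E mu _ (@measurable_set_coord i)
  (@gauss_set_coordE i) _ mF iX).
rewrite -(@integral12_prod_meas1 _ _ _ _ _ mu gam (EFin \o (F \o set_coord i)))//.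
by rewrite /fubini_F integral0_eq// => y _ /=; exact: F0.
Qed.

(** Gaussian integration by parts in coordinate i: with the other coordinates
frozen, F is y_i times a polynomial in y_i and G is the derivative of this
polynomial. *)
Lemma Ex_stein i F G (p : 'cV[R]_d -> {poly R}) : tame F -> tame G ->
  (forall (y : gvec R d) z, F (set_coord i (y, z)) = z * (p y).[z]) ->
  (forall (y : gvec R d) z, G (set_coord i (y, z)) = (p y)^`().[z]) ->
  Ex F = s ^+ 2 * Ex G.
Proof.
move=> tF tG hF hG; apply/eqP; rewrite -subr_eq0 -ExZ// -ExB//; last exact: tameZ.
apply/eqP; apply: (@Ex_set_coord0 i); first by apply: tameB => //; exact: tameZ.
move=> y; under eq_integral do rewrite hF hG.
exact: integral_normal_prob_stein.
Qed.

Lemma dotp_set_coord a i y z : dotp a (set_coord i (y, z)) = a i 0 * z + \sum_(j | j != i) a j 0 * y j 0.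
Proof.
rewrite /dotp (bigD1 i)//= mxE eqxx; congr (_ + _); apply: eq_bigr => j /negbTE ji.
by rewrite mxE ji.
Qed.

Lemma Ex_coord_dotpX a i n :
  Ex (fun y => y i 0 * dotp a y ^+ n) = s ^+ 2 * (n%:R * a i 0 * Ex (fun y => dotp a y ^+ n.-1)).
Proof.
have tL m : tame (fun y => dotp a y ^+ m) by apply: tameX; exact: tame_dotp.
rewrite -ExZ//.
apply: (@Ex_stein i _ _ (fun y => (a i 0 *: 'X + (\sum_(j | j != i) a j 0 * y j 0)%:P) ^+ n)).
- by apply: tameM => //; exact: tame_coord.
- exact: tameZ.
- by move=> y z; rewrite dotp_set_coord mxE eqxx !hornerE.
- move=> y z; rewrite dotp_set_coord deriv_exp derivD derivZ derivX derivC !hornerE.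
  by rewrite hornerMn !hornerE; ring.
Qed.

Lemma Ex_coord2_dotpX a i j n :
  Ex (fun y => y i 0 * (y j 0 * dotp a y ^+ n)) =
  s ^+ 2 * ((i == j)%:R * Ex (fun y => dotp a y ^+ n)
            + n%:R * a i 0 * Ex (fun y => y j 0 * dotp a y ^+ n.-1)).
Proof.
have tL m : tame (fun y => dotp a y ^+ m) by apply: tameX; exact: tame_dotp.
have tcL m : tame (fun y => y j 0 * dotp a y ^+ m) by apply: tameM => //; exact: tame_coord.
rewrite -ExZ// -ExZ// -ExD; try exact: tameZ.
apply: (@Ex_stein i _ _ (fun y => (if i == j then 'X else (y j 0)%:P) * (a i 0 *: 'X + (\sum_(j | j
  != i) a j 0 * y j 0)%:P) ^+ n)).
- by apply: tameM => //; exact: tame_coord.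
- by apply: tameD; exact: tameZ.
- move=> y z; rewrite dotp_set_coord !mxE eqxx !hornerE eq_sym.
  by case: eqP => _; rewrite !hornerE.
- move=> y z; rewrite dotp_set_coord mxE eq_sym derivM deriv_exp derivD derivZ derivX derivC.
  by case: eqP => _; rewrite ?derivX ?derivC !hornerE/= !hornerMn !hornerE/=; ring.
Qed.

(** Integration by parts gives the same recursion in q as for the moments of a
standard normal variable, up to the factor s^2 |a|^2: the variable [dotp a y] is
normal with this variance. *)
Lemma Ex_dotp_even a q :
  Ex (fun y => dotp a y ^+ (2 * q)) = (s ^+ 2 * dotp a a) ^+ q * normal_moment R (2 * q).
Proof.
have tL m : tame (fun y => dotp a y ^+ m) by apply: tameX; exact: tame_dotp.
elim: q => [|q IH].
  rewrite muln0 expr0 mul1r normal_moment0.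
  by under eq_fun do rewrite expr0; exact: Ex_cst.
rewrite mulnS add2n normal_momentSS exprS mulrACA -[X in _ * X]IH.
under eq_fun do rewrite exprS {1}/dotp mulr_suml.
rewrite Ex_sum; last by move=> i; apply: tameM => //; apply: tameZ; exact: tame_coord.
rewrite (eq_bigr (fun i => s ^+ 2 * (2 * q).+1%:R * Ex (fun y => dotp a y ^+ (2 * q)) * (a i 0 * a i 0))).
  by rewrite -mulr_sumr /dotp; ring.
move=> i _; under eq_fun do rewrite -mulrA.
rewrite ExZ; last by apply: tameM => //; exact: tame_coord.
by rewrite Ex_coord_dotpX/=; ring.
Qed.

(** Two integrations by parts, first in coordinate i and then in coordinate j. For
q = 0 the factor of the Kronecker symbol is 1, since q.-1 = q there; for q > 0 it
restores the exponent q. *)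
Lemma Ex_coord2_dotp_even a i j q :
  Ex (fun y => y i 0 * (y j 0 * dotp a y ^+ (2 * q))) =
  s ^+ 2 * (s ^+ 2 * dotp a a) ^+ q.-1 * normal_moment R (2 * q) *
   ((i == j)%:R * (if q is 0 then 1 else s ^+ 2 * dotp a a)
            + (2 * q)%:R * (s ^+ 2 * (a i 0 * a j 0))).
Proof.
rewrite Ex_coord2_dotpX Ex_dotp_even.
case: q => [|q]; first by rewrite muln0/= expr0; ring.
rewrite mulnS add2n/= Ex_coord_dotpX/= Ex_dotp_even normal_momentSS [_ ^+ q.+1]exprS; ring.
Qed.

Lemma Ex_coord2 i j : Ex (fun y => y i 0 * y j 0) = s ^+ 2 * (i == j)%:R.
Proof.
have := Ex_coord2_dotp_even 0 i j 0.
rewrite muln0 normal_moment0 !mxE; under eq_fun do rewrite expr0 mulr1.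
by move=> ->; rewrite /= expr0; ring.
Qed.

Lemma Ex_l1_even q : Ex (fun y => l1 y ^+ (2 * q.+1)) <=
  d%:R ^+ (2 * q.+1) * d%:R * normal_moment R (2 * q.+1) * s ^+ (2 * q.+1).
Proof.
pose m := (2 * q).+1.
have -> : (2 * q.+1 = m.+1)%N by rewrite mulnS.
rewrite (@le_trans _ _ (Ex (fun y => d%:R ^+ m.+1 * \sum_i `|y i 0| ^+ m.+1)))//.
  apply: le_Ex; first exact: tameX tame_l1.
    by apply: tameZ; apply: tame_sum => i; apply: tameX; apply: tame_abs; exact: tame_coord.
  by move=> y; exact: expr_sum_le.
have E i : Ex (fun y => `|y i 0| ^+ m.+1) = normal_moment R m.+1 * s ^+ m.+1.
  have := Ex_dotp_even (delta_mx i 0) q.+1.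
  have dE y : dotp (delta_mx i 0) y = y i 0.
    rewrite /dotp (bigD1 i)//= mxE !eqxx mul1r big1 ?addr0// => j /negbTE ji.
    by rewrite mxE ji mul0r.
  rewrite dE mxE !eqxx mulr1 -exprM (_ : (2 * q.+1 = m.+1)%N) ?mulnS// mulrC => <-.
  congr Ex; apply/funext => y; rewrite dE.
  have -> : m.+1 = (2 * q.+1)%N by rewrite mulnS.
  by rewrite !exprM real_normK ?num_real.
rewrite ExZ; last by apply: tame_sum => i; apply: tameX; apply: tame_abs; exact: tame_coord.
rewrite Ex_sum; last by move=> i; apply: tameX; apply: tame_abs; exact: tame_coord.
by rewrite (eq_bigr _ (fun i _ => E i)) sumr_const card_ord -[X in _ * X <= _]mulr_natl !mulrA.
Qed.

End gauss_vector.

(** * Derivatives along lines and symmetry of mixed partials *)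

Section line_derivative.
Context {R : realType} {d : nat}.
Implicit Types (f l : 'cV[R]_d -> R) (y v w : 'cV[R]_d).

Lemma mvt_le (g g' : R -> R) (B b : R) : 0 <= b ->
  (forall r : R, is_derive r 1 g (g' r)) -> (forall r, 0 <= r <= b -> `|g' r| <= B) ->
  `|g b - g 0| <= B * b.
Proof.
move=> b0 dg gB.
have cg : {within `[0, b], continuous g}.
  apply: continuous_subspaceT => x.
  by apply/differentiable_continuous/derivable1_diffP; case: (dg x).
have [c cb ->] := MVT_segment b0 (fun x _ => dg x) cg.
by rewrite subr0 normrM [X in _ * X]ger0_norm// ler_wpM2r// gB.
Qed.

Lemma is_deriveP (g : R -> R) (r l : R) : is_derive r 1 g l <->
  h^-1 * (g (h + r) - g r) @[h --> 0^'] --> l.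
Proof.
have E : (fun h : R => h^-1 *: ((g \o shift r) (h *: 1) - g r)) =
         (fun h : R => h^-1 * (g (h + r) - g r)).
  by apply/funext => h; rewrite /GRing.scale/= mulr1.
split=> [[dg <-]|gl]; first by rewrite /derive E; move: dg; rewrite /derivable E.
split; first by rewrite /derivable E; apply/cvg_ex; exists l.
by rewrite /derive E; exact: cvg_lim.
Qed.

(** Derivative in direction v at all points of all lines directed by v. Unlike
differentiability at a point, this combines well with the mean value theorem. *)
Definition line_derive f v l := forall y (r : R),
  is_derive r 1 (fun r : R => f (y + r *: v)) (l (y + r *: v)).

Lemma derivable_line_derive f v : (forall y, derivable f y v) ->
  line_derive f v (fun y => 'D_v f y).
Proof.
move=> df y r; apply/is_deriveP.
have -> : (fun h : R => h^-1 * (f (y + (h + r) *: v) - f (y + r *: v)))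
       = (fun h : R => h^-1 *: ((f \o shift (y + r *: v)) (h *: v) - f (y + r *: v))).
  by apply/funext => h; rewrite scalerDl addrCA.
exact: df.
Qed.

Lemma line_derive0 f : line_derive f 0 (fun=> 0).
Proof.
move=> y r; rewrite (_ : (fun r => _) = cst (f y)).
  exact: is_derive_cst.
by apply/funext => h; rewrite scaler0 addr0.
Qed.

Lemma line_deriveZ f v l (c : R) : line_derive f v l ->
  line_derive f (c *: v) (fun y => c * l y).
Proof.
move=> dl y r.
have dc : is_derive r 1 (fun x : R => c * x) c.
  have := is_deriveZ c (is_derive_id r (1 : R)).
  by rewrite /GRing.scale/= mulr1.
have := is_derive1_comp (dl y (c * r)) dc.
by rewrite /comp mulrC scalerA [r * c]mulrC; under eq_fun do rewrite mulrC -scalerA.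
Qed.

(** The increment along v + w is an increment along v followed by one along w from
a displaced point; the mean value theorem and the continuity of [lw] make the
displacement harmless. *)
Lemma line_deriveD f v w lv lw : line_derive f v lv -> line_derive f w lw ->
  continuous lw -> line_derive f (v + w) (fun y => lv y + lw y).
Proof.
move=> dv dw cw y r; pose Y := y + r *: (v + w).
apply/is_deriveP.
have -> : (fun h : R => h^-1 * (f (y + (h + r) *: (v + w)) - f (y + r *: (v + w)))) =
     (fun h : R => h^-1 * (f (Y + h *: v) - f Y) + h^-1 * (f (Y + h *: v + h *: w) - f (Y + h *: v))).
  apply/funext => h; rewrite -mulrDr; congr (_ * _).
  rewrite addrC [in RHS]addrC addrA subrK addrC; congr (f _ - _).
  by rewrite /Y [in LHS]scalerDl [h *: (v + w)]scalerDr addrCA addrC !addrA.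
apply: cvgD.
  have /is_deriveP := dv Y 0.
  by rewrite scale0r addr0; under eq_fun do rewrite addr0.
apply/cvgrPdist_le => e e0.
have /cvgrPdist_le/(_ _ e0) := cw Y.
move=> /nbhs_ballP[de /= de0 hde].
near=> h.
have hn0 : h != 0 by near: h; exact: nbhs_dnbhs_neq.
have hs : `|h| < de / (`|v| + `|w| + 1).
  by near: h; apply: dnbhs0_lt; rewrite divr_gt0// ltr_wpDl// addr_ge0.
pose g a := f (Y + h *: v + a *: (h *: w)) - a * (h * lw Y).
have dg (a : R) : is_derive a 1 g (h * lw (Y + h *: v + a *: (h *: w)) - h * lw Y).
  have d1 := line_deriveZ h dw (Y + h *: v) a.
  have d2 : is_derive a 1 (fun x : R => x * (h * lw Y)) (h * lw Y).
    have := is_deriveZ (h * lw Y) (is_derive_id a (1 : R)).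
    rewrite /GRing.scale_fun /GRing.scale/= mulr1.
    by under eq_fun do rewrite mulrC.
  exact: is_deriveB.
have gb a : 0 <= a <= 1 -> `|h * lw (Y + h *: v + a *: (h *: w)) - h * lw Y| <= `|h| * e.
  move=> /andP[a0 a1]; rewrite -mulrBr normrM ler_wpM2l// distrC; apply: hde.
  rewrite -ball_normE /= -[Y + _ + _]addrA [- (Y + _)]opprD addNKr normrN.
  rewrite (le_lt_trans (ler_normD _ _))// !normrZ (ger0_norm a0).
  rewrite (@le_lt_trans _ _ (`|h| * (`|v| + `|w| + 1)))//; last first.
    by rewrite -ltr_pdivlMr// ltr_wpDl// addr_ge0.
  rewrite !mulrDr -addrA lerD2l mulr1 (@le_trans _ _ (`|h| * `|w|)) ?lerDl//.
  by rewrite ler_piMl// mulr_ge0.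
have := mvt_le ler01 dg gb.
rewrite /g scale1r scale0r addr0 mul0r subr0 mul1r mulr1 => H.
rewrite -(ler_pM2l (_ : 0 < `|h|)) ?normr_gt0// -normrM mulrBr mulrA divff// mul1r.
by rewrite distrC addrAC.
Unshelve. all: end_near. Qed.

Lemma line_derive_sum (f : 'cV[R]_d -> R) (I : Type) (r : seq I) (u : I -> 'cV[R]_d) (l : I -> 'cV[R]_d -> R) :
  (forall i, line_derive f (u i) (l i)) -> (forall i, continuous (l i)) ->
  line_derive f (\sum_(i <- r) u i) (fun y => \sum_(i <- r) l i y).
Proof.
move=> dl cl; elim: r => [|i r IH].
  rewrite big_nil; under [X in line_derive _ _ X]eq_fun do rewrite big_nil.
  exact: line_derive0.
rewrite big_cons; under [X in line_derive _ _ X]eq_fun do rewrite big_cons.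
have := line_deriveD IH (dl i) (cl i); rewrite addrC.
by under [X in line_derive _ _ X -> _]eq_fun do rewrite addrC.
Qed.

(** The chain rule along lines for a function with continuous partial
derivatives. *)
Lemma line_derive_total (f : 'cV[R]_d -> R) (l : 'I_d -> 'cV[R]_d -> R) (z : 'cV[R]_d) :
  (forall i, line_derive f (delta_mx i 0) (l i)) -> (forall i, continuous (l i)) ->
  line_derive f z (fun y => \sum_i z i 0 * l i y).
Proof.
move=> dl cl.
have := @line_derive_sum f _ (index_enum 'I_d) (fun i => z i 0 *: delta_mx i 0) (fun i y => z i 0 * l i y).
have -> : \sum_i z i 0 *: delta_mx i 0 = z.
  by rewrite [RHS](matrix_sum_delta z); apply: eq_bigr => i _; rewrite big_ord1.
apply => [i|i y]; [exact: line_deriveZ|].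
apply: (@continuousM _ _ (fun=> z i 0) (l i)); [exact: cst_continuous|exact: cl].
Qed.

(** A second difference over a parallelogram with sides h u and h w is h^2 times a
value of either mixed derivative near y; let h tend to 0. *)
Lemma schwarz (f fi fj fij fji : 'cV[R]_d -> R) (u w y : 'cV[R]_d) :
  line_derive f u fi -> line_derive f w fj ->
  line_derive fi w fij -> line_derive fj u fji ->
  continuous fij -> continuous fji -> fij y = fji y.
Proof.
have key (g gu guw : 'cV[R]_d -> R) (u' w' : 'cV[R]_d) (h : R) : 0 < h ->
    line_derive g u' gu -> line_derive gu w' guw ->
    exists2 p : R * R, [/\ 0 <= p.1 <= h & 0 <= p.2 <= h] &
     g (y + h *: u' + h *: w') - g (y + h *: u') - g (y + h *: w') + g y =
       h ^+ 2 * guw (y + p.1 *: u' + p.2 *: w').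
  move=> h0 du duw.
  have cder (k k' : R -> R) : (forall r : R, is_derive r 1 k (k' r)) -> {within `[0, h], continuous k}.
    move=> dk; apply: continuous_subspaceT => x.
    by apply/differentiable_continuous/derivable1_diffP; case: (dk x).
  pose phi (r : R) := g (y + h *: w' + r *: u') - g (y + r *: u').
  have dphi (r : R) : is_derive r 1 phi (gu (y + h *: w' + r *: u') - gu (y + r *: u')).
    by apply: is_deriveB; exact: du.
  have [p1 p1h E1] := MVT_segment (ltW h0) (fun x _ => dphi x) (cder _ _ dphi).
  have [p2 p2h E2] := MVT_segment (ltW h0) (fun x _ => duw (y + p1 *: u') x) (cder _ _ (duw (y + p1 *: u'))).
  exists (p1, p2); first by move: p1h p2h; rewrite !in_itv.
  move: E1 E2; rewrite /phi !subr0 !scale0r !addr0 addrAC => E1.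
  rewrite addrAC => E2.
  rewrite E2 in E1.
  have R1 : h ^+ 2 * guw (y + p1 *: u' + p2 *: w') = guw (y + p1 *: u' + p2 *: w') * h * h by ring.
  rewrite /= R1 -E1.
  by rewrite [y + h *: u' + h *: w']addrAC; ring.
move=> du dw duw dwu cij cji.
apply/eqP/negPn/negP => ne.
pose e := `|fij y - fji y| / 2.
have e0 : 0 < e by rewrite divr_gt0// normr_gt0 subr_eq0.
have /cvgrPdist_lt/(_ _ e0)/nbhs_ballP[d1 /= d10 H1] := cij y.
have /cvgrPdist_lt/(_ _ e0)/nbhs_ballP[d2 /= d20 H2] := cji y.
pose h := Num.min d1 d2 / (`|u| + `|w| + 1).
have n0 : 0 < `|u| + `|w| + 1 by rewrite ltr_wpDl// addr_ge0.
have h0 : 0 < h by rewrite divr_gt0// lt_min d10.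
have hn (a b : R) (u' w' : 'cV[R]_d) : 0 <= a <= h -> 0 <= b <= h -> `|u'| + `|w'| = `|u| + `|w| ->
    `|y - (y + a *: u' + b *: w')| < Num.min d1 d2.
  move=> /andP[a0 ah] /andP[b0 bh] uw; rewrite -[y + _ + _]addrA [- (y + _)]opprD addNKr normrN.
  rewrite (le_lt_trans (ler_normD _ _))// !normrZ (ger0_norm a0) (ger0_norm b0).
  rewrite (@le_lt_trans _ _ (h * (`|u| + `|w|)))//.
    by rewrite -uw mulrDr lerD// ler_wpM2r.
  by rewrite /h -mulrA gtr_pMr ?lt_min ?d10// ltr_pdivrMl// mulr1 ltrDl.
have [[p1 p2] /= [hp1 hp2] E1] := key _ _ _ _ _ _ h0 du duw.
have [[q1 q2] /= [hq1 hq2] E2] := key _ _ _ _ _ _ h0 dw dwu.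
have h20 : h ^+ 2 != 0 by rewrite expf_neq0// gt_eqF.
have E : fij (y + p1 *: u + p2 *: w) = fji (y + q1 *: w + q2 *: u).
  apply: (mulfI h20); rewrite -E1 -E2 [y + h *: w + _]addrAC; ring.
have := H1 (y + p1 *: u + p2 *: w); rewrite -ball_normE /= => /(_ _)/wrap[].
  by rewrite (lt_le_trans (hn _ _ _ _ hp1 hp2 erefl))// ge_min lexx.
have := H2 (y + q1 *: w + q2 *: u); rewrite -ball_normE /= => /(_ _)/wrap[].
  by rewrite (lt_le_trans (hn _ _ _ _ hq1 hq2 (addrC _ _)))// ge_min lexx orbT.
rewrite -E => b1 b2.
have := ler_distD (fij (y + p1 *: u + p2 *: w)) (fij y) (fji y).
rewrite [X in _ <= _ + X]distrC => hh.
have : `|fij y - fji y| < e + e by rewrite (le_lt_trans hh)// ltrD.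
by rewrite /e -splitr ltxx.
Qed.

End line_derivative.

Section time_derivative.
Context {R : realType}.

(** Near an interior time the difference quotient within [0, T] is the two-sided
one. *)
Lemma quotient_is_derive (T t : R) (f : R -> R) (l : R) : 0 < t < T ->
  (fun r => (r - t)^-1 * (f r - f t)) @ within `[0, T] t^' --> l ->
  is_derive t 1 f l.
Proof.
move=> /andP[t0 tT] fl; apply/is_deriveP.
apply/cvgrPdist_lt => e e0.
have /cvgrPdist_lt/(_ _ e0) := fl.
rewrite /within /dnbhs /= => /nbhs_ballP[de /= de0 H].
near=> h.
have hn0 : h != 0 by near: h; exact: nbhs_dnbhs_neq.
have hd : `|h| < de by near: h; exact: dnbhs0_lt.
have ht : `|h| < t by near: h; exact: dnbhs0_lt.
have hT : `|h| < T - t by near: h; apply: dnbhs0_lt; rewrite subr_gt0.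
have := H (h + t); rewrite addrK; apply.
- by rewrite -ball_normE /= opprD addrCA subrr addr0 normrN.
- by rewrite -subr_eq0 addrK.
- move: ht hT; rewrite !ltr_norml /= in_itv/= => /andP[h1 h2] /andP[h3 h4]; lra.
Unshelve. all: end_near. Qed.

End time_derivative.

Lemma is_derive_mulc {R : realType} (c r : R) : is_derive r 1 (fun x : R => x * c) c.
Proof.
have := is_deriveZ c (is_derive_id r (1 : R)).
rewrite /GRing.scale_fun /GRing.scale/= mulr1.
by under eq_fun do rewrite mulrC.
Qed.

Lemma is_derive_suml {R : realType} (I : Type) (r : seq I) (c : I -> R)
    (g g' : I -> R -> R) (t : R) : (forall i, is_derive t 1 (g i) (g' i t)) ->
  is_derive t 1 (fun u => \sum_(i <- r) c i * g i u) (\sum_(i <- r) c i * g' i t).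
Proof.
move=> dg; elim: r => [|i r IH].
  by rewrite big_nil; under eq_fun do rewrite big_nil; exact: is_derive_cst.
rewrite big_cons; under eq_fun do rewrite big_cons.
by apply: is_deriveD; exact: is_deriveZ.
Qed.

(** * Taylor estimates for smooth bounded functions *)

Section smooth.
Context {R : realType} {d : nat}.
Variables (T : R) (v : R -> 'cV[R]_d -> R).
Hypothesis sv : smooth_bounded T v.
Implicit Types (s : seq (option 'I_d)) (w : seq 'I_d) (x y z : 'cV[R]_d) (t : R).
Local Notation pd s := (pderiv T s v).

Lemma pderiv_continuous s t : 0 <= t <= T -> continuous (pd s t).
Proof.
move=> tT y; have [_ + _] := sv s.
move=> /subspace_continuousP/(_ (t, y) tT) H.
apply: (@cvg_comp _ _ _ (fun y => (t, y)) (fun z : R * 'cV[R]_d => pd s z.1 z.2) _ _ _ _ H).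
have P : (t, y') @[y' --> y] --> (t, y).
  move=> A /nbhs_ballP[e /= e0 eA]; apply/nbhs_ballP; exists e => // y' hy.
  by apply: eA; split => //=; exact: ballxx.
move=> A HA.
have HA' : nbhs y ((fun y' => (t, y')) @^-1` (fun z : R * 'cV[R]_d => 0 <= z.1 <= T -> A z)) := P _ HA.
change (nbhs y ((fun y' => (t, y')) @^-1` A)).
by apply: filterS HA' => z; apply.
Qed.

Lemma pderiv_time_continuous s x : {within `[0, T], continuous (fun t => pd s t x)}.
Proof.
have [_ + _] := sv s => /subspace_continuousP H.
apply/subspace_continuousP => t tT.
have tT' : 0 <= t <= T by move: tT; rewrite /= in_itv.
apply: (@cvg_comp _ _ _ (fun t => (t, x)) (fun z : R * 'cV[R]_d => pd s z.1 z.2) _ _ _ _ (H (t, x) tT')).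
have P : (t', x) @[t' --> t] --> (t, x).
  move=> A /nbhs_ballP[e /= e0 eA]; apply/nbhs_ballP; exists e => // t' ht.
  by apply: eA; split => //=; exact: ballxx.
move=> A; rewrite /within/= => /P HA.
change (within `[0, T]%classic (nbhs t) ((fun t' => (t', x)) @^-1` A)).
have HA' : nbhs t ((fun t' => (t', x)) @^-1` (fun z : R * 'cV[R]_d => 0 <= z.1 <= T -> A z)) := HA.
by rewrite /within/=; apply: filterS HA' => z /= + zT; apply; move: zT; rewrite in_itv.
Qed.

Lemma pderiv_line s i t : 0 <= t <= T ->
  line_derive (pd s t) (delta_mx i 0) (pd (Some i :: s) t).
Proof.
move=> tT; apply: derivable_line_derive => y.
by have [/(_ (Some i) t y tT)] := sv s.
Qed.

Lemma pderiv_swap i j s t x : 0 <= t <= T ->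
  pd (Some i :: Some j :: s) t x = pd (Some j :: Some i :: s) t x.
Proof.
move=> tT; apply: (@schwarz _ _ (pd s t) (pd (Some j :: s) t) (pd (Some i :: s) t) _ _ (delta_mx j
  0) (delta_mx i 0)).
- exact: pderiv_line.
- exact: pderiv_line.
- exact: pderiv_line.
- exact: pderiv_line.
- exact: pderiv_continuous.
- exact: pderiv_continuous.
Qed.

Lemma pderiv_front i w t : 0 <= t <= T -> i \in w ->
  pd (map Some w) t = pd (map Some (i :: rem i w)) t.
Proof.
move=> tT; elim: w => // j w IH; rewrite inE => /orP[/eqP ->|iw].
  by rewrite /= eqxx.
have [->|ij] := eqVneq i j; first by rewrite /= eqxx.
have IH' := IH iw.
rewrite /= eq_sym (negbTE ij); apply/funext => x.
transitivity (pd (Some j :: map Some (i :: rem i w)) t x).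
  by rewrite /pderiv /= -!/(pderiv _ _ _) IH'.
exact: pderiv_swap.
Qed.

Lemma pderiv_perm w w' t : 0 <= t <= T -> perm_eq w w' ->
  pd (map Some w) t = pd (map Some w') t.
Proof.
move=> tT; elim: w' w => [|i w' IH] w; first by move=> /perm_nilP ->.
move=> ww'; have iw : i \in w by rewrite (perm_mem ww') mem_head.
rewrite (pderiv_front tT iw).
have E : perm_eq (rem i w) w'.
  by rewrite -(perm_cons i) (perm_trans _ ww')// perm_sym perm_to_rem.
have F w1 : pd (map Some (i :: w1)) t = fun x => 'D_(delta_mx i 0) (pd (map Some w1) t) x by [].
by rewrite !F (IH _ E).
Qed.

Lemma pderiv1_time_congr (phi psi : R -> 'cV[R]_d -> R) :
  (forall t, 0 <= t <= T -> phi t = psi t) ->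
  forall t x, 0 <= t <= T -> pderiv1 T None phi t x = pderiv1 T None psi t x.
Proof.
move=> pp t x tT /=; congr lim; apply/seteqP; split => A /=.
- rewrite /within/= /nbhs/=; apply: filterS => r H rT; have := H rT.
  by rewrite /time_quotient !pp//; move: rT; rewrite /= in_itv.
- rewrite /within/= /nbhs/=; apply: filterS => r H rT; have := H rT.
  by rewrite /time_quotient !pp//; move: rT; rewrite /= in_itv.
Qed.

(** Derivatives in space commute, so only the multiplicity of each direction
matters. This brings any sequence of directions to the order used in
[mixed_index]. *)
Lemma pderiv_time_perm a w w' t : 0 <= t <= T -> perm_eq w w' ->
  pd (nseq a None ++ map Some w) t = pd (nseq a None ++ map Some w') t.
Proof.
move=> + ww'; elim: a t => [|a IH] t tT; first exact: pderiv_perm.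
by apply/funext => x; exact: pderiv1_time_congr.
Qed.

Lemma mixed_index_perm w a : exists2 w', perm_eq w w' &
  mixed_index a (fun i => count_mem i w) = nseq a None ++ map Some w'.
Proof.
exists (flatten [seq nseq (count_mem i w) i | i <- enum 'I_d]).
  apply/allP => i _; apply/eqP; rewrite count_flatten -map_comp sumnE big_map.
  rewrite big_enum/= (bigD1 i)//= count_nseq/= eqxx mul1n big1 ?addn0// => j ji.
  by rewrite count_nseq/= (negbTE ji).
rewrite /mixed_index map_flatten -map_comp; congr (_ ++ flatten _).
by apply: eq_map => i /=; rewrite map_nseq.
Qed.

(** There are finitely many multi-indices of given length, and each derivative is
bounded. Without this bound the supremum would carry no information. *)
Lemma deriv_seminorm_ubound a q :
  has_ubound [set y : R | exists t x (beta : 'I_d -> nat),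
    [/\ 0 <= t <= T, (\sum_i beta i)%N = q & y = `|pd (mixed_index a beta) t x|]].
Proof.
have /choice[B HB] : forall g : {ffun 'I_d -> 'I_q.+1}, exists B : R,
    forall t x, 0 <= t <= T -> `|pd (mixed_index a (fun i => g i : nat)) t x| <= B.
  by move=> g; have [_ _] := sv (mixed_index a (fun i => g i : nat)).
exists (\sum_g `|B g|) => _ [t [x [beta [tT bq ->]]]].
pose g : {ffun 'I_d -> 'I_q.+1} := [ffun i => inord (beta i)].
have bg : beta = (fun i => g i : nat).
  apply/funext => i; rewrite ffunE inordK// ltnS -bq.
  by rewrite (bigD1 i)//= leq_addr.
rewrite bg (le_trans (HB g t x tT))// (le_trans (ler_norm _))//.
by rewrite (bigD1 g)//= lerDl sumr_ge0.
Qed.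

(** The only form in which the hypothesis on the seminorms is used. *)
Lemma pderiv_le_seminorm a w t x : 0 <= t <= T ->
  `|pd (nseq a None ++ map Some w) t x| <= deriv_seminorm T v a (size w).
Proof.
move=> tT; apply: ub_le_sup; first exact: deriv_seminorm_ubound.
exists t, x, (fun i => count_mem i w); split=> //.
  elim: w => [|i w IH] /=; first exact: big1.
  rewrite big_split/= IH (bigD1 i)//= eqxx big1 ?addn0// => j /negbTE.
  by rewrite eq_sym => ->.
have [w' ww' ->] := mixed_index_perm w a.
by rewrite (pderiv_time_perm a tT ww').
Qed.

Lemma pderiv_time s x t : 0 < t < T ->
  is_derive t 1 (fun t => pd s t x) (pd (None :: s) t x).
Proof.
move=> tT; apply: (quotient_is_derive tT).
have tT' : 0 <= t <= T by move: tT => /andP[/ltW -> /ltW ->].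
by have [/(_ None t x tT') /= H _ _] := sv s.
Qed.

Lemma time_increment_le s x t (h B : R) : 0 <= t -> 0 <= h -> t + h <= T ->
  (forall r, 0 <= r <= T -> `|pd (None :: s) r x| <= B) ->
  `|pd s (t + h) x - pd s t x| <= h * B.
Proof.
move=> t0 h0 thT HB.
have cs : {within `[t, t + h], continuous (fun t => pd s t x)}.
  have sub : `[t, t + h]%classic `<=` `[0, T]%classic.
    by move=> r /=; rewrite !in_itv/=; lra.
  exact: continuous_subspaceW sub (@pderiv_time_continuous s x).
have ds (r : R) : r \in `]t, t + h[ -> is_derive r 1 (fun t => pd s t x) (pd (None :: s) r x).
  by rewrite in_itv/= => /andP[r1 r2]; apply: pderiv_time; apply/andP; split; lra.
have tth : t <= t + h by rewrite lerDl.
have [c cth ->] := MVT_segment tth ds cs.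
rewrite addrAC subrr add0r normrM mulrC (ger0_norm h0) ler_wpM2l// HB//.
by move: cth; rewrite in_itv/= => /andP[c1 c2]; apply/andP; split; lra.
Qed.

Lemma time_taylor_le s x t (h B : R) : 0 <= t -> 0 <= h -> t + h <= T ->
  (forall r, 0 <= r <= T -> `|pd (None :: None :: s) r x| <= B) ->
  `|pd s (t + h) x - pd s t x - h * pd (None :: s) t x| <= h ^+ 2 * B.
Proof.
move=> t0 h0 thT HB.
have cs : {within `[t, t + h], continuous (fun t => pd s t x)}.
  have sub : `[t, t + h]%classic `<=` `[0, T]%classic.
    by move=> r /=; rewrite !in_itv/=; lra.
  exact: continuous_subspaceW sub (@pderiv_time_continuous s x).
have ds (r : R) : r \in `]t, t + h[ -> is_derive r 1 (fun t => pd s t x) (pd (None :: s) r x).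
  by rewrite in_itv/= => /andP[r1 r2]; apply: pderiv_time; apply/andP; split; lra.
have tth : t <= t + h by rewrite lerDl.
have [c cth ->] := MVT_segment tth ds cs.
rewrite addrAC subrr add0r mulrC -mulrBr normrM (ger0_norm h0) expr2 -mulrA ler_wpM2l//.
move: cth; rewrite in_itv/= => /andP[c1 c2].
have B0 : 0 <= B by rewrite (le_trans _ (HB t _))//; apply/andP; split; lra.
have ct0 : 0 <= c - t by rewrite subr_ge0.
have := @time_increment_le (None :: s) x t (c - t) B t0 ct0.
rewrite addrC subrK => /(_ _ HB) H; have cT : c <= T by lra.
by rewrite (le_trans (H cT))// ler_wpM2r//; lra.
Qed.

(** The n-th derivative in direction z, expanded over the partial derivatives. *)
Fixpoint dir_pderiv (n : nat) (z : 'cV[R]_d) (s : seq (option 'I_d)) (t : R) (y : 'cV[R]_d) : R :=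
  if n is n'.+1 then \sum_i z i 0 * dir_pderiv n' z (Some i :: s) t y else pd s t y.

Lemma dir_pderiv_line n z s t : 0 <= t <= T ->
  line_derive (dir_pderiv n z s t) z (dir_pderiv n.+1 z s t).
Proof.
move=> tT; elim: n s => [|n IH] s.
  apply: line_derive_total => i; first exact: pderiv_line.
  exact: pderiv_continuous.
move=> y r.
apply: (@is_derive_suml R 'I_d (index_enum 'I_d) (fun i => z i 0) (fun i r => dir_pderiv n z (Some
  i :: s) t (y + r *: z)) (fun i r => dir_pderiv n.+1 z (Some i :: s) t (y + r *: z))) => i.
exact: IH.
Qed.

Lemma dir_pderiv_le n z w t y B :
  (forall w', size w' = (n + size w)%N -> `|pd (map Some w') t y| <= B) ->
  `|dir_pderiv n z (map Some w) t y| <= l1 z ^+ n * B.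
Proof.
elim: n w => [|n IH] w HB /=; first by rewrite expr0 mul1r HB.
rewrite (le_trans (ler_norm_sum _ _ _))// exprS -mulrA mulr_suml.
apply: ler_sum => i _; rewrite normrM ler_wpM2l//.
by apply: (IH (i :: w)) => w' sw; apply: HB; rewrite sw /= addnS.
Qed.

Lemma space_increment_le w z t y B : 0 <= t <= T ->
  (forall w' x, size w' = (size w).+1 -> `|pd (map Some w') t x| <= B) ->
  `|pd (map Some w) t (y + z) - pd (map Some w) t y| <= l1 z * B.
Proof.
move=> tT HB.
have H r : 0 <= r <= 1 -> `|dir_pderiv 1 z (map Some w) t (y + r *: z)| <= l1 z * B.
  by move=> _; rewrite -[l1 z]expr1; apply: dir_pderiv_le => w' sw; exact: HB.
by have := mvt_le ler01 (fun r => dir_pderiv_line 0 z (map Some w) tT y r) H;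
  rewrite scale1r scale0r addr0 mulr1.
Qed.

(** Two mean value estimates along the segment from y to y + z. *)
Lemma space_taylor1_le z t y B : 0 <= t <= T ->
  (forall w x, size w = 2 -> `|pd (map Some w) t x| <= B) ->
  `|pd [::] t (y + z) - pd [::] t y - dir_pderiv 1 z [::] t y| <= l1 z ^+ 2 * B.
Proof.
move=> tT HB.
pose F n (r : R) := dir_pderiv n z [::] t (y + r *: z).
have dF n (r : R) : is_derive r 1 (F n) (F n.+1 r) by exact: dir_pderiv_line.
have F2 r : 0 <= r <= 1 -> `|F 2 r| <= l1 z ^+ 2 * B.
  by move=> _; apply: (@dir_pderiv_le 2 z [::]) => w sw; exact: HB.
have B0 : 0 <= l1 z ^+ 2 * B by rewrite (le_trans _ (F2 0 _))// lexx ler01.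
have F1 r : 0 <= r <= 1 -> `|F 1%N r - F 1%N 0| <= l1 z ^+ 2 * B.
  move=> /andP[r0 r1]; have := mvt_le r0 (dF 1%N) (B := l1 z ^+ 2 * B).
  move=> H; rewrite (le_trans (H _))//; last by rewrite ler_piMr.
  by move=> u /andP[u0 ur]; apply: F2; rewrite u0 (le_trans ur).
(* chi' r = F 1 r - F 1 0 is bounded by F1 *)
pose chi (r : R) := F 0%N r - r * F 1%N 0.
have dchi (r : R) : is_derive r 1 chi (F 1%N r - F 1%N 0).
  by apply: is_deriveB; exact: is_derive_mulc.
have := mvt_le ler01 dchi F1.
by rewrite mulr1 /chi /F !scale1r !scale0r !addr0 mul0r subr0 mul1r addrAC.
Qed.

(** With F r the value at y + r z, the function
F r + F (- r) - 2 F 0 - r^2 F'' 0 vanishes at 0 together with its first three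
derivatives, and its fourth derivative is bounded: four mean value estimates. *)
Lemma space_even_le z t y B : 0 <= t <= T ->
  (forall w x, size w = 4 -> `|pd (map Some w) t x| <= B) ->
  `|pd [::] t (y + z) + pd [::] t (y - z) - 2 * pd [::] t y - dir_pderiv 2 z [::] t y|
    <= 2 * (l1 z ^+ 4 * B).
Proof.
move=> tT HB.
pose F n (r : R) := dir_pderiv n z [::] t (y + r *: z).
have dF n (r : R) : is_derive r 1 (F n) (F n.+1 r) by exact: dir_pderiv_line.
have dFN n (r : R) : is_derive r 1 (fun r => F n (- r)) (- F n.+1 (- r)).
  have := is_derive1_comp (dF n (- r)) (is_deriveNid r 1).
  by rewrite mulrN1.
pose C := 2 * (l1 z ^+ 4 * B).
have F4 (r : R) : `|F 4 r| <= l1 z ^+ 4 * B.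
  by apply: (@dir_pderiv_le 4 z [::]) => w sw; exact: HB.
have C0 : 0 <= C by rewrite /C mulr_ge0// (le_trans _ (F4 0)).
(* a function vanishing at 0 inherits on [0, 1] the bound of its derivative *)
have step (g g' : R -> R) : g 0 = 0 -> (forall r : R, is_derive r 1 g (g' r)) ->
    (forall r, 0 <= r <= 1 -> `|g' r| <= C) -> forall r, 0 <= r <= 1 -> `|g r| <= C.
  move=> g0 dg gC r /andP[r0 r1].
  have H := mvt_le r0 dg (B := C); rewrite g0 subr0 in H.
  rewrite (le_trans (H _))//; last by rewrite ler_piMr.
  by move=> u /andP[u0 ur]; apply: gC; rewrite u0 (le_trans ur).
have c4 r : 0 <= r <= 1 -> `|F 4 r - (- F 4 (- r))| <= C.
  by move=> _; rewrite opprK (le_trans (ler_normD _ _))// /C mulrDl !mul1r lerD.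
have c3 : forall r, 0 <= r <= 1 -> `|F 3 r - F 3 (- r)| <= C.
  apply: (step _ _ _ _ c4); first by rewrite oppr0 subrr.
have c2 : forall r, 0 <= r <= 1 -> `|F 2 r + F 2 (- r) - 2 * F 2 0| <= C.
  apply: (step _ _ _ _ c3); first by rewrite oppr0; ring.
  move=> r; rewrite -[X in is_derive _ _ _ X]subr0.
  exact: (is_deriveB (is_deriveD (dF 2 r) (dFN 2 r)) (is_derive_cst _ _ _)).
have c1 : forall r, 0 <= r <= 1 -> `|F 1%N r - F 1%N (- r) - r * (2 * F 2 0)| <= C.
  apply: (step _ _ _ _ c2); first by rewrite oppr0; ring.
  move=> r; rewrite -[F 2 (- r)]opprK.
  exact: (is_deriveB (is_deriveB (dF 1%N r) (dFN 1%N r)) (is_derive_mulc _ _)).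
have c0 : forall r, 0 <= r <= 1 -> `|F 0%N r + F 0%N (- r) - 2 * F 0%N 0 - r ^+ 2 * F 2 0| <= C.
  apply: (step _ _ _ _ c1); first by rewrite oppr0; ring.
  move=> r; rewrite -[F 1%N r - F 1%N (- r)]subr0.
  have H : is_derive r 1 (fun r : R => r ^+ 2 * F 2 0) (r * (2 * F 2 0)).
    have H2 : is_derive r 1 (fun r : R => r ^+ 2) (2 * r).
      by apply: is_derive_eq; rewrite /GRing.scale/=; ring.
    have := is_deriveZ (F 2 0) H2; rewrite /GRing.scale_fun /GRing.scale/=.
    by under eq_fun do rewrite mulrC; rewrite mulrCA [F 2 0 * r]mulrC mulrCA.
  exact: (is_deriveB (is_deriveB (is_deriveD (dF 0%N r) (dFN 0%N r)) (is_derive_cst _ _ _)) H).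
have := c0 1; rewrite ler01 lexx => /(_ isT).
by rewrite /F expr1n mul1r scale1r scaleN1r scale0r addr0.
Qed.

End smooth.

(** * Norms of vectors and matrices *)

Section norms.
Context {R : realType}.

Lemma sqr_norm2 m n (A : 'M[R]_(m, n)) : norm2 A ^+ 2 = \sum_i \sum_j A i j ^+ 2.
Proof.
by rewrite sqr_sqrtr// sumr_ge0// => i _; rewrite sumr_ge0// => j _; rewrite sqr_ge0.
Qed.

Lemma norm2_ge0 m n (A : 'M[R]_(m, n)) : 0 <= norm2 A.
Proof. exact: sqrtr_ge0. Qed.

Lemma abs_le_norm2 m n (A : 'M[R]_(m, n)) i j : `|A i j| <= norm2 A.
Proof.
rewrite -(@ler_pXn2r _ 2) ?nnegrE ?norm2_ge0// sqr_norm2 real_normK ?num_real//.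
rewrite (bigD1 i)//= (bigD1 j)//= -addrA lerDl addr_ge0// sumr_ge0// => k _.
  exact: sqr_ge0.
by rewrite sumr_ge0// => l _; exact: sqr_ge0.
Qed.

Lemma sqr_norm2_col d l (S : 'M[R]_(d, l)) : \sum_j norm2 (col j S) ^+ 2 = norm2 S ^+ 2.
Proof.
rewrite sqr_norm2 exchange_big/=; apply: eq_bigr => j _.
by rewrite sqr_norm2; apply: eq_bigr => i _; rewrite big_ord1 mxE.
Qed.

Lemma sqr_norm2_dotp d (c : 'cV[R]_d) : norm2 c ^+ 2 = dotp c c.
Proof. by rewrite sqr_norm2; apply: eq_bigr => i _; rewrite big_ord1 expr2. Qed.

Lemma dotpDl n (a b c : 'cV[R]_n) : dotp (a + b) c = dotp a c + dotp b c.
Proof. by rewrite /dotp -big_split; apply: eq_bigr => i _; rewrite mxE mulrDl. Qed.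

Lemma dotp_le_l1 d (c y : 'cV[R]_d) C : (forall i, `|c i 0| <= C) -> `|dotp c y| <= C * l1 y.
Proof.
move=> cC; rewrite (le_trans (ler_norm_sum _ _ _))// /l1 mulr_sumr ler_sum// => i _.
by rewrite normrM ler_wpM2r.
Qed.

Lemma l1_bound d (c : 'cV[R]_d) C : (forall i, `|c i 0| <= C) -> l1 c <= d%:R * C.
Proof.
move=> cC; rewrite (le_trans (ler_sum _ (fun i _ => cC i)))//.
by rewrite sumr_const card_ord mulr_natl.
Qed.

Lemma l1Z d (h : R) (c : 'cV[R]_d) : l1 (h *: c) = `|h| * l1 c.
Proof. by rewrite /l1 mulr_sumr; apply: eq_bigr => i _; rewrite mxE normrM. Qed.

Lemma l1D d (a b : 'cV[R]_d) : l1 (a + b) <= l1 a + l1 b.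
Proof. by rewrite /l1 -big_split ler_sum// => i _; rewrite mxE ler_normD. Qed.

Lemma l1_mulmx d (S : 'M[R]_d) (y : 'cV[R]_d) C : norm2 S <= C ->
  l1 (S *m y) <= d%:R * C * l1 y.
Proof.
move=> SC; rewrite -mulrA; apply: l1_bound => i.
rewrite mxE (_ : \sum_j _ = dotp (\col_j S i j) y).
  by apply: dotp_le_l1 => j; rewrite mxE (le_trans (abs_le_norm2 _ _ _)).
by apply: eq_bigr => j _; rewrite mxE.
Qed.

Lemma mulmx_entry_le m n p (A : 'M[R]_(m, n)) (B : 'M[R]_(n, p)) a b :
  (forall i j, `|A i j| <= a) -> (forall i j, `|B i j| <= b) -> 0 <= a ->
  forall i j, `|(A *m B) i j| <= n%:R * (a * b).
Proof.
move=> hA hB a0 i j; rewrite mxE (le_trans (ler_norm_sum _ _ _))//.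
rewrite (@le_trans _ _ (\sum_(k < n) a * b))//.
  by apply: ler_sum => k _; rewrite normrM ler_pM.
by rewrite sumr_const card_ord mulr_natl.
Qed.

(** 2 a b <= a^2 + b^2 for the entries of two rows of S. The bound does not involve
the number of columns, on which the final constant may not depend. *)
Lemma gram_entry_le d l (S : 'M[R]_(d, l)) C : norm2 S <= C ->
  forall i j, `|(S *m S^T) i j| <= C ^+ 2.
Proof.
move=> SC i j; rewrite mxE (@le_trans _ _ (norm2 S ^+ 2))//; last first.
  by rewrite lerXn2r ?nnegrE ?norm2_ge0// (le_trans _ SC)// norm2_ge0.
have row_le a : \sum_k S a k ^+ 2 <= norm2 S ^+ 2.
  rewrite sqr_norm2 (bigD1 a)//= lerDl sumr_ge0// => b _.
  by rewrite sumr_ge0// => k _; exact: sqr_ge0.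
rewrite (le_trans (ler_norm_sum _ _ _))//.
rewrite (@le_trans _ _ (\sum_k 2^-1 * (S i k ^+ 2 + S j k ^+ 2)))//.
  apply: ler_sum => k _; rewrite mxE normrM.
  have := sqr_ge0 (`|S i k| - `|S j k|).
  rewrite -(real_normK (num_real (S i k))) -(real_normK (num_real (S j k))); nra.
by rewrite -mulr_sumr big_split/=; have := row_le i; have := row_le j; lra.
Qed.

End norms.

(** * Moments of the length of a Gaussian vector *)

Section gauss_moments.
Context {R : realType} {d : nat}.
Variables (s : R) (mu : probability (gvec R d) R).
Hypothesis s0 : 0 < s.
Hypothesis muE : forall A : 'I_d -> set R, (forall i, measurable (A i)) ->
  mu (box A) = (\prod_i fine (normal_prob 0 s (A i)))%:E.
Implicit Types (g c y : 'cV[R]_d).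

(** A bound for the n-th moment of the l1 norm of a standard Gaussian vector,
derived from the even moment of order 2 n + 2. *)
Definition l1_moment (n : nat) : R :=
  1 + d%:R ^+ (2 * n.+1) * d%:R * normal_moment R (2 * n.+1).

Lemma l1_moment_ge0 n : 0 <= l1_moment n.
Proof.
by rewrite addr_ge0// mulr_ge0 ?mulr_ge0 ?exprn_ge0// ltW// normal_moment_even_gt0.
Qed.

(** t^n <= 1 + t^(2n+2) at t = |y|_1 / s reduces odd moments to even ones. *)
Lemma Ex_l1X_le n : Ex mu (fun y => l1 y ^+ n) <= l1_moment n * s ^+ n.
Proof.
have tl m : tame (fun y : 'cV[R]_d => l1 y ^+ m) by apply: tameX; exact: tame_l1.
have s1 : 0 < s ^- n.+2 by rewrite invr_gt0 exprn_gt0.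
have H y : l1 y ^+ n <= s ^+ n + s ^- n.+2 * l1 y ^+ (2 * n.+1).
  have a0 : 0 <= l1 y / s by rewrite divr_ge0 ?l1_ge0 ?ltW.
  have : (l1 y / s) ^+ n <= 1 + (l1 y / s) ^+ (2 * n.+1).
    have [a1|a1] := leP (l1 y / s) 1.
      by rewrite (le_trans (exprn_ile1 _ a0 a1))// lerDl exprn_ge0.
    rewrite (@le_trans _ _ ((l1 y / s) ^+ (2 * n.+1))) ?lerDr// ler_eXn2l//.
    by rewrite mul2n -addnn (leq_trans (leqnSn n))// leq_addr.
  rewrite !expr_div_n ler_pdivrMr ?exprn_gt0// => /le_trans; apply.
  rewrite mulrDl mul1r lerD2l mulrAC -mulrA mulrC ler_wpM2r ?exprn_ge0 ?l1_ge0//.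
  rewrite (_ : (2 * n.+1 = n + n.+2)%N); last by rewrite mul2n -addnn !addnS !addSn.
  by rewrite exprD invfM mulrA mulfV ?mul1r// expf_neq0 ?gt_eqF.
have tS : tame (fun y => s ^+ n + s ^- n.+2 * l1 y ^+ (2 * n.+1)).
  by apply: tameD; [exact: tame_cst|exact: tameZ].
rewrite (le_trans (le_Ex s0 muE (tl n) tS H))//.
rewrite (ExD s0 muE); [|exact: tame_cst|exact: tameZ].
rewrite Ex_cst (ExZ s0 muE)// /l1_moment mulrDl mul1r lerD2l.
rewrite mulrC ler_pdivrMr ?exprn_gt0// (le_trans (Ex_l1_even s0 muE n))//.
by rewrite -[leRHS]mulrA -exprD mul2n -addnn !addnS !addSn.
Qed.

End gauss_moments.

(** * Moments of the two weights *)

Section weights.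
Context {R : realType} {d : nat}.
Variables (h : R) (mu : probability (gvec R d) R).
Hypothesis h0 : 0 < h.
Local Notation s := (Num.sqrt h).
Hypothesis muE : forall A : 'I_d -> set R, (forall i, measurable (A i)) ->
  mu (box A) = (\prod_i fine (normal_prob 0 s (A i)))%:E.
Local Notation Exm := (Ex mu).
Implicit Types (g c y : 'cV[R]_d).

Let s0 : 0 < s. Proof. by rewrite sqrtr_gt0. Qed.

Let s2 : s ^+ 2 = h. Proof. by rewrite sqr_sqrtr// ltW. Qed.

(** Positive and negative parts written with absolute values. The first summand
is odd in y and carries the drift, the second is even and will not contribute. *)
Lemma poly1E g y : poly1 g y = \sum_i (g i 0 * y i 0 + `|g i 0| * `|y i 0|).
Proof.
rewrite /poly1 /dotp -big_split/= mulr_sumr; apply: eq_bigr => i _.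
by rewrite !mxE !maxr_absE !minr_absE !subr0 !addr0; field.
Qed.

Lemma poly1_abs_le g y C : norm2 g <= C -> `|poly1 g y| <= 2 * C * l1 y.
Proof.
move=> gC; rewrite poly1E (le_trans (ler_norm_sum _ _ _))// /l1 mulr_sumr.
apply: ler_sum => i _; have gi := le_trans (abs_le_norm2 g i 0) gC.
rewrite (le_trans (ler_normD _ _))// !normrM !normr_id.
by have := ler_wpM2r (normr_ge0 (y i 0)) gi; lra.
Qed.

Lemma tame_scale_coord (a : R) i : tame (fun y => (a *: y) i 0).
Proof. by under eq_fun do rewrite mxE; exact/tameZ/tame_coord. Qed.

Lemma tame_poly1 g (a : R) : tame (fun y => poly1 g (a *: y)).
Proof.
under eq_fun do rewrite poly1E; apply: tame_sum => i.
by apply: tameD; apply: tameZ; [|apply: tame_abs]; exact: tame_scale_coord.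
Qed.

(** The even part of the weight is multiplied by an odd coordinate and integrates
to 0; the linear part gives g by the covariance s^2 = h. *)
Lemma Ex_coord_poly1 g i : Exm (fun y => y i 0 * poly1 g (h^-1 *: y)) = g i 0.
Proof.
pose E y := y i 0 * \sum_j `|g j 0| * `|(h^-1 *: y) j 0|.
have tE : tame E.
  apply: tameM; first exact: tame_coord.
  by apply: tame_sum => j; apply: tameZ; apply: tame_abs; exact: tame_scale_coord.
have E0 : Exm E = 0.
  have := Ex_opp s0 muE tE.
  rewrite (_ : (fun y => E (- y)) = fun y => (-1) * E y).
    by rewrite (ExZ s0 muE)//; lra.
  apply/funext => y; rewrite /E mulrA !mxE mulN1r; congr (_ * _).
  by apply: eq_bigr => j _; rewrite !mxE mulrN normrN.
have tyy j : tame (fun y => y i 0 * y j 0) by apply: tameM; exact: tame_coord.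
rewrite (_ : (fun y => _) = fun y => (\sum_j h^-1 * g j 0 * (y i 0 * y j 0)) + E y).
  rewrite (ExD s0 muE)//; last by apply: tame_sum => j; exact: tameZ.
  rewrite E0 addr0 (Ex_sum s0 muE); last by move=> j; exact: tameZ.
  under eq_bigr do rewrite (ExZ s0 muE)// (Ex_coord2 s0 muE) s2.
  rewrite (bigD1 i)//= eqxx big1 ?addr0.
    by rewrite mulr1; field; rewrite gt_eqF.
  by move=> j /negbTE ji; rewrite eq_sym ji !mulr0.
apply/funext => y; rewrite /E poly1E big_split/= mulrDr mulr_sumr; congr (_ + _).
by apply: eq_bigr => j _; rewrite mxE; ring.
Qed.

Section even_power.
Variable k : nat.
Local Notation q := (2 * k).+1.
Local Notation mom := (normal_moment R (2 * q)).

Let pE : (4 * k + 2 = 2 * q)%N.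
Proof. by rewrite mulnS mulnA addnC. Qed.

Let mom0 : 0 < mom. Proof. exact: normal_moment_even_gt0. Qed.

(** This relation is what makes [column_weight] centred. *)
Lemma c_coef_moment : c_coef R k * mom = d_coef R k.
Proof.
by rewrite /c_coef /d_coef pE invfM -mulrA mulVf ?mulr1// gt_eqF.
Qed.

Lemma c_coef_ge0 : 0 <= c_coef R k.
Proof. by rewrite invr_ge0 pE mulr_ge0// ltW. Qed.

Lemma d_coef_ge0 : 0 <= d_coef R k.
Proof. by rewrite invr_ge0. Qed.

(** The contribution of one column c of Sig to [poly2], as a function of the
increment y before its rescaling by s. *)
Definition column_weight c y : R := if norm2 c == 0 then 0 else
  norm2 c ^+ 2 * (c_coef R k * (dotp c y / (s * norm2 c)) ^+ (2 * q) - d_coef R k).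

Lemma poly2E l (Sig : 'M[R]_(d, l)) y :
  poly2 Sig k (s^-1 *: y) = \sum_j column_weight (col j Sig) y.
Proof.
apply: eq_bigr => j _; rewrite /column_weight; case: ifP => // _.
rewrite pE; congr (_ * (_ * _ ^+ _ - _)).
rewrite invfM mulrA; congr (_ / _).
rewrite -scalemxAr mxE mulrC; congr (_ / _).
by rewrite mxE; apply: eq_bigr => i _; rewrite !mxE.
Qed.

Lemma column_weightN c y : column_weight c (- y) = column_weight c y.
Proof.
rewrite /column_weight; case: ifP => // _; congr (_ * (_ * _ - _)).
have -> : dotp c (- y) = - dotp c y.
  by rewrite /dotp -sumrN; apply: eq_bigr => i _; rewrite mxE mulrN.
by rewrite mulNr exprM sqrrN -exprM.
Qed.

Let column_weightE c : norm2 c != 0 -> column_weight c = fun y =>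
  norm2 c ^+ 2 * c_coef R k * (s * norm2 c) ^- (2 * q) * dotp c y ^+ (2 * q)
   - norm2 c ^+ 2 * d_coef R k.
Proof.
move=> /negbTE c0; apply/funext => y; rewrite /column_weight c0 expr_div_n.
ring.
Qed.

Let tame_dotpX c n : tame (fun y => dotp c y ^+ n).
Proof. by apply: tameX; exact: tame_dotp. Qed.

Lemma tame_column_weight c : tame (column_weight c).
Proof.
have [c0|c0] := eqVneq (norm2 c) 0.
  by rewrite /column_weight; under eq_fun do rewrite c0 eqxx; exact: tame_cst.
by rewrite column_weightE//; apply: tameB; [exact: tameZ|exact: tame_cst].
Qed.

Lemma Ex_column_weight c : Exm (column_weight c) = 0.
Proof.
have [c0|c0] := eqVneq (norm2 c) 0.
  by rewrite /column_weight; under eq_fun do rewrite c0 eqxx; rewrite Ex_cst.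
rewrite column_weightE// (ExB s0 muE) ?Ex_cst; [|exact: tameZ|exact: tame_cst].
rewrite (ExZ s0 muE)// (Ex_dotp_even s0 muE) -sqr_norm2_dotp -exprMn -exprM.
rewrite -c_coef_moment; field.
by rewrite !expf_neq0//= mulf_neq0// gt_eqF.
Qed.

(** Of the two terms produced by integration by parts, the one in the Kronecker
symbol is cancelled by d_k; the other one has coefficient (4 k + 2) d_k = 1. *)
Lemma Ex_coord2_column_weight c i j :
  Exm (fun y => y i 0 * y j 0 * column_weight c y) = h * (c i 0 * c j 0).
Proof.
have [c0|c0] := eqVneq (norm2 c) 0.
  rewrite /column_weight; under eq_fun do rewrite c0 eqxx mulr0.
  rewrite Ex_cst; have := abs_le_norm2 c i 0.
  by rewrite c0 normr_le0 => /eqP ->; rewrite mul0r mulr0.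
have tyy : tame (fun y => y i 0 * y j 0) by apply: tameM; exact: tame_coord.
have typ : tame (fun y => y i 0 * (y j 0 * dotp c y ^+ (2 * q))).
  by do 2 (apply: tameM => //; first exact: tame_coord).
rewrite column_weightE// (_ : (fun y => _) = fun y =>
  norm2 c ^+ 2 * c_coef R k * (s * norm2 c) ^- (2 * q) * (y i 0 * (y j 0 * dotp c y ^+ (2 * q)))
   - norm2 c ^+ 2 * d_coef R k * (y i 0 * y j 0)); last by apply/funext => y; ring.
rewrite (ExB s0 muE) ?(ExZ s0 muE)//; [|exact: tameZ|exact: tameZ].
rewrite (Ex_coord2_dotp_even s0 muE) (Ex_coord2 s0 muE) -sqr_norm2_dotp -exprMn -exprM s2.
have E : (s * norm2 c) ^- (2 * q) * (h * (s * norm2 c) ^+ (2 * q.-1)) = norm2 c ^- 2.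
  rewrite /= mulnS exprD; set z := (s * norm2 c) ^+ (2 * (2 * k)).
  have z0 : z != 0 by rewrite expf_neq0// mulf_neq0// gt_eqF.
  by rewrite exprMn s2; field; rewrite c0 z0 gt_eqF.
have DE : d_coef R k * (2 * q)%:R = 1.
  by rewrite /d_coef pE mulVf// pnatr_eq0.
rewrite (_ : _ * _ * _ ^- _ * _ = norm2 c ^+ 2 * (c_coef R k * mom) *
  ((s * norm2 c) ^- (2 * q) * (h * (s * norm2 c) ^+ (2 * q.-1))) * ((i == j)%:R * (s * norm2 c) ^+
    2 + (2 * q)%:R * (h * (c i 0 * c j 0)))); last by ring.
rewrite E c_coef_moment exprMn s2.
rewrite (_ : _ - _ = d_coef R k * (2 * q)%:R * (h * (c i 0 * c j 0))); last by field.
by rewrite DE mul1r.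
Qed.

Lemma column_weight_abs_le c y :
  `|column_weight c y| <= norm2 c ^+ 2 * (c_coef R k * (l1 y / s) ^+ (2 * q) + d_coef R k).
Proof.
have L0 : 0 <= l1 y / s by rewrite divr_ge0 ?l1_ge0 ?ltW.
rewrite /column_weight; case: ifPn => [/eqP ->|c0].
  by rewrite normr0 expr2 !mul0r.
have nc0 : 0 < norm2 c by rewrite lt_def c0 norm2_ge0.
rewrite normrM (ger0_norm (sqr_ge0 _)) ler_wpM2l ?sqr_ge0//.
rewrite (le_trans (ler_normB _ _))// (ger0_norm d_coef_ge0) lerD2r.
rewrite normrM (ger0_norm c_coef_ge0) ler_wpM2l ?c_coef_ge0// normrX lerXn2r ?nnegrE//.
rewrite normrM normfV (ger0_norm (mulr_ge0 (ltW s0) (ltW nc0))) ler_pdivrMr ?mulr_gt0//.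
rewrite (_ : _ * (_ * _) = norm2 c * l1 y); last by field; rewrite gt_eqF.
by apply: dotp_le_l1 => i; exact: abs_le_norm2.
Qed.

Variables (l : nat) (Sig : 'M[R]_(d, l)).
Local Notation P2 := (fun y => poly2 Sig k (s^-1 *: y)).

Lemma tame_poly2 : tame P2.
Proof.
by under eq_fun do rewrite poly2E; apply: tame_sum => j; exact: tame_column_weight.
Qed.

Lemma poly2N y : P2 (- y) = P2 y.
Proof. by rewrite /= !poly2E; apply: eq_bigr => j _; exact: column_weightN. Qed.

Lemma Ex_poly2 : Exm P2 = 0.
Proof.
under eq_fun do rewrite poly2E.
rewrite (Ex_sum s0 muE); last by move=> j; exact: tame_column_weight.
by rewrite big1// => j _; exact: Ex_column_weight.
Qed.

Lemma Ex_coord2_poly2 i j :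
  Exm (fun y => y i 0 * y j 0 * P2 y) = h * (Sig *m Sig^T) i j.
Proof.
under eq_fun do rewrite poly2E mulr_sumr.
rewrite (Ex_sum s0 muE).
  rewrite mxE mulr_sumr; apply: eq_bigr => a _.
  by rewrite Ex_coord2_column_weight !mxE.
move=> a; apply: tameM; last exact: tame_column_weight.
by apply: tameM; exact: tame_coord.
Qed.

(** Summing over the columns of Sig leaves only its Frobenius norm, so the bound
does not depend on the number of columns. *)
Lemma Ex_l1_poly2_le C : norm2 Sig <= C ->
  Exm (fun y => l1 y ^+ 4 * `|P2 y|) <=
   h ^+ 2 * (C ^+ 2 * (c_coef R k * @l1_moment R d (2 * q + 4) + d_coef R k * @l1_moment R d 4)).
Proof.
move=> SC.
have tl n : tame (fun y => l1 y ^+ n) by apply: tameX; exact: tame_l1.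
have C0 : 0 <= C ^+ 2 by exact: sqr_ge0.
pose G y := C ^+ 2 * (c_coef R k * s ^- (2 * q) * l1 y ^+ (2 * q + 4) + d_coef R k * l1 y ^+ 4).
have tG : tame G by apply: tameZ; apply: tameD; exact: tameZ.
have H y : l1 y ^+ 4 * `|P2 y| <= G y.
  have Pb : `|P2 y| <= C ^+ 2 * (c_coef R k * (l1 y / s) ^+ (2 * q) + d_coef R k).
    rewrite poly2E (le_trans (ler_norm_sum _ _ _))//.
    rewrite (le_trans (ler_sum _ (fun j _ => column_weight_abs_le (col j Sig) y)))//.
    rewrite -mulr_suml sqr_norm2_col ler_wpM2r//.
      rewrite addr_ge0 ?d_coef_ge0// mulr_ge0 ?c_coef_ge0// exprn_ge0//.
      by rewrite divr_ge0 ?l1_ge0 ?ltW.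
    by rewrite lerXn2r ?nnegrE ?norm2_ge0// (le_trans _ SC)// norm2_ge0.
  rewrite (le_trans (ler_wpM2l _ Pb)) ?exprn_ge0 ?l1_ge0// /G expr_div_n exprD.
  by rewrite le_eqVlt; apply/orP; left; apply/eqP; ring.
rewrite (le_trans (le_Ex s0 muE _ tG H))//.
  by apply: tameM => //; apply: tame_abs; exact: tame_poly2.
rewrite /G (ExZ s0 muE); last by apply: tameD; exact: tameZ.
rewrite (ExD s0 muE) ?(ExZ s0 muE)//; [|exact: tameZ|exact: tameZ].
rewrite mulrCA ler_wpM2l// mulrDr.
have s4 : s ^+ 4 = h ^+ 2 by rewrite (exprM s 2 2) s2.
apply: lerD.
  have := Ex_l1X_le s0 muE (2 * q + 4); rewrite exprD s4 => H1.
  rewrite (le_trans (ler_wpM2l _ H1)).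
  - by [].
  - by rewrite mulr_ge0 ?c_coef_ge0// invr_ge0 exprn_ge0// ltW.
  - by rewrite le_eqVlt; apply/orP; left; apply/eqP; field; rewrite expf_neq0// gt_eqF.
have := Ex_l1X_le s0 muE 4; rewrite s4 => H1.
rewrite (le_trans (ler_wpM2l d_coef_ge0 H1))//.
by rewrite le_eqVlt; apply/orP; left; apply/eqP; ring.
Qed.

End even_power.

End weights.

(** * Consistency of one Gaussian step *)

Section local.
Context {R : realType} {d : nat}.
Variables (T : R) (v : R -> 'cV[R]_d -> R).
Hypothesis sv : smooth_bounded T v.
Variables (h : R) (mu : probability (gvec R d) R).
Hypothesis h0 : 0 < h.
Local Notation s := (Num.sqrt h).
Hypothesis muE : forall A : 'I_d -> set R, (forall i, measurable (A i)) ->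
  mu (box A) = (\prod_i fine (normal_prob 0 s (A i)))%:E.
Local Notation Exm := (Ex mu).
Implicit Types (P : 'cV[R]_d -> R) (x y z : 'cV[R]_d) (S : 'M[R]_d).

Let s0 : 0 < s. Proof. by rewrite sqrtr_gt0. Qed.

Let s2 : s ^+ 2 = h. Proof. by rewrite sqr_sqrtr// ltW. Qed.

Let s4 : s ^+ 4 = h ^+ 2. Proof. by rewrite (exprM s 2 2) s2. Qed.

(** Measurability needs the continuity of v in space, and growth is trivial as v is
bounded. *)
Lemma tame_affine (t : R) x S : 0 <= t <= T -> tame (fun y => v t (x + S *m y)).
Proof.
move=> tT; split.
  have mX : measurable_fun setT (fun y : gvec R d => (x + S *m (y : 'cV[R]_d)) : gvec R d).
    apply: measurable_gvec => i.
    rewrite (_ : (fun w => _) = (fun w : gvec R d => x i 0 + \sum_j S i j * (w : 'cV[R]_d) j 0)).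
      apply: measurable_funD; first exact: measurable_cst.
      apply: measurable_sum => j; apply: measurable_funM; first exact: measurable_cst.
      exact: measurable_coord.
    by apply/funext => w; rewrite !mxE.
  have mv := continuous_measurable_gvec (pderiv_continuous sv (s := [::]) tT).
  exact: (measurableT_comp mv mX).
have [_ _ [B HB]] := sv [::].
exists `|B|, 0%N; split=> // y; rewrite expr0 (le_trans (HB t _ tT))//.
by rewrite (le_trans (ler_norm _))// ler_peMr// lerDl.
Qed.

Lemma dir_pderiv1E z (t : R) y : dir_pderiv T v 1 z [::] t y = dotp z (gradient T v t y).
Proof. by apply: eq_bigr => i _; rewrite mxE. Qed.

Lemma dir_pderiv2E z (t : R) y : dir_pderiv T v 2 z [::] t y = quadform (hessian T v t y) z.
Proof.
rewrite /quadform /dotp /=; under eq_bigr do rewrite mulr_sumr.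
rewrite exchange_big/=; apply: eq_bigr => j _; rewrite mxE mulr_sumr.
by apply: eq_bigr => i _; rewrite mxE/=; ring.
Qed.

(** The coordinates are in the order (l, k) so that the covariance of N appears as
the second factor of a matrix product. *)
Lemma quadformE S (H : 'M[R]_d) y :
  quadform H (S *m y) = \sum_k \sum_l (S^T *m H *m S) k l * (y l 0 * y k 0).
Proof.
have -> : quadform H (S *m y) = (y^T *m (S^T *m H *m S) *m y) 0 0.
  rewrite !mulmxA -trmx_mul -!mulmxA mxE; apply: eq_bigr => i _.
  by rewrite [_^T _ _]mxE.
rewrite mxE; under eq_bigr do rewrite mxE mulr_suml.
rewrite exchange_big/=; apply: eq_bigr => k _; apply: eq_bigr => l _.
by rewrite [_^T _ _]mxE; ring.
Qed.

Lemma tame_quadform S (H : 'M[R]_d) : tame (fun y => quadform H (S *m y)).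
Proof.
under eq_fun do rewrite quadformE.
apply: tame_sum => k; apply: tame_sum => l; apply: tameZ.
by apply: tameM; exact: tame_coord.
Qed.

Lemma Ex_quadform P (M S H : 'M[R]_d) : tame P ->
  (forall k l, Exm (fun y => y k 0 * y l 0 * P y) = h * M k l) ->
  Exm (fun y => quadform H (S *m y) * P y) = h * \tr (S *m M *m S^T *m H).
Proof.
move=> tP PM.
have tc k l : tame (fun y => y l 0 * y k 0 * P y).
  by do 2 apply: tameM => //; exact: tame_coord.
have -> : \tr (S *m M *m S^T *m H) = \tr (S^T *m H *m S *m M).
  by rewrite -!mulmxA mulmxA mxtrace_mulC !mulmxA.
rewrite (_ : (fun y => _) = fun y => \sum_k \sum_l (S^T *m H *m S) k l * (y l 0 * y k 0 * P y)).
  rewrite (Ex_sum s0 muE); last by move=> k; apply: tame_sum => l; exact: tameZ.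
  rewrite mulr_sumr; apply: eq_bigr => k _.
  rewrite (Ex_sum s0 muE); last by move=> l; exact: tameZ.
  rewrite mxE mulr_sumr; apply: eq_bigr => l _.
  by rewrite (ExZ s0 muE)// PM mulrCA.
apply/funext => y; rewrite quadformE mulr_suml; apply: eq_bigr => k _.
by rewrite mulr_suml; apply: eq_bigr => l _; rewrite -mulrA.
Qed.

Variables (t Kt del : R).
Hypotheses (t0 : 0 <= t) (thT : t + h <= T) (del1 : 1 <= del) (Kt0 : 0 <= Kt).
Hypothesis bnd : forall a w (r : R) x n, 0 <= r <= T -> (2 * a + size w = n.+1)%N ->
  `|pderiv T (nseq a None ++ map Some w) v r x| <= Kt * del ^+ n.

Let tT : 0 <= t <= T. Proof. by rewrite t0 (le_trans _ thT)// lerDl ltW. Qed.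

Let tT' : 0 <= t + h <= T. Proof. by rewrite thT addr_ge0// ltW. Qed.

(** Since P is even, v at + S y and at - S y have the same weighted expectation;
their sum has no odd Taylor terms, and the remainder of order 4 is integrated
against |P|. *)
Lemma weighted_taylor_le x S P (M : 'M[R]_d) C : norm2 S <= C -> tame P ->
  (forall y, P (- y) = P y) ->
  (forall k l, Exm (fun y => y k 0 * y l 0 * P y) = h * M k l) ->
  `|Exm (fun y => v (t + h) (x + S *m y) * P y) - v (t + h) x * Exm P
     - h / 2 * \tr (S *m M *m S^T *m hessian T v (t + h) x)|
  <= Kt * del ^+ 3 * (d%:R * C) ^+ 4 * Exm (fun y => l1 y ^+ 4 * `|P y|).
Proof.
move=> SC tP Pe PM.
pose f y := v (t + h) (x + S *m y).
have tf : tame f by exact: tame_affine.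
have tfN : tame (fun y => f (- y)).
  rewrite (_ : (fun y => _) = fun y => v (t + h) (x + (- S) *m y)); first exact: tame_affine.
  by apply/funext => y; rewrite /f mulmxN mulNmx.
pose H := hessian T v (t + h) x.
(* twice the even part of the Taylor remainder of order 2 at x *)
pose Q y := f y + f (- y) - 2 * v (t + h) x - quadform H (S *m y).
have tQ : tame Q.
  by apply: tameB (tame_quadform _ _); apply: tameB (tame_cst _); exact: tameD.
have QB y : `|Q y| <= 2 * (Kt * del ^+ 3 * (d%:R * C) ^+ 4 * l1 y ^+ 4).
  have := @space_even_le _ _ T v sv (S *m y) (t + h) x (Kt * del ^+ 3) tT'.
  rewrite dir_pderiv2E -mulmxN => H4; rewrite (le_trans (H4 _))//.
    by move=> w z sw; apply: (bnd (a := 0)).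
  rewrite ler_wpM2l// mulrC -[leRHS]mulrA ler_wpM2l//.
    by rewrite mulr_ge0// exprn_ge0// (le_trans ler01).
  have C0 : 0 <= C by rewrite (le_trans _ SC)// norm2_ge0.
  have := l1_mulmx y SC; rewrite -exprMn => ?.
  by rewrite lerXn2r ?nnegrE ?l1_ge0// !mulr_ge0// l1_ge0.
have EQ : Exm (fun y => Q y * P y) =
    2 * (Exm (fun y => f y * P y) - v (t + h) x * Exm P - h / 2 * \tr (S *m M *m S^T *m H)).
  rewrite (_ : (fun y => _) = fun y => f y * P y + f (- y) * P (- y)
       - 2 * v (t + h) x * P y - quadform H (S *m y) * P y).
    have t1 : tame (fun y => f y * P y) by exact: tameM.
    have t2 : tame (fun y => f (- y) * P (- y)).
      by under eq_fun do rewrite Pe; exact: tameM.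
    have t3 : tame (fun y => 2 * v (t + h) x * P y) by exact: tameZ.
    have t4 : tame (fun y => quadform H (S *m y) * P y) by apply: tameM => //; exact: tame_quadform.
    rewrite (ExB s0 muE) ?(ExB s0 muE) ?(ExD s0 muE) ?(ExZ s0 muE) ?(Ex_quadform _ _ tP PM)//.
      by rewrite (Ex_opp s0 muE t1); field.
    - by apply: tameD.
    - by apply: tameB => //; apply: tameD.
  by apply/funext => y; rewrite Pe /Q; ring.
have tlP : tame (fun y => l1 y ^+ 4 * `|P y|).
  by apply: tameM; [apply: tameX; exact: tame_l1|exact: tame_abs].
rewrite -(ler_pM2l (_ : 0 < 2))// -[X in X * `|_|]ger0_norm// -normrM -EQ mulrA -(ExZ s0 muE)//.
apply: (Ex_norm_le s0 muE); [exact: tameM|exact: tameZ|] => y.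
by rewrite normrM [leRHS]mulrA ler_wpM2r// (le_trans (QB y))// mulrA.
Qed.

Lemma trace_mul_le (A B : 'M[R]_d) (a b : R) : (forall i j, `|A i j| <= a) ->
  (forall i j, `|B i j| <= b) -> 0 <= a -> `|\tr (A *m B)| <= d%:R ^+ 2 * (a * b).
Proof.
move=> hA hB a0; rewrite (le_trans (ler_norm_sum _ _ _))//.
rewrite (le_trans (ler_sum _ (fun i _ => mulmx_entry_le hA hB a0 i i)))//.
by rewrite sumr_const card_ord -[leLHS]mulr_natl expr2 -mulrA.
Qed.

Let del0 : 0 <= del. Proof. exact: le_trans ler01 del1. Qed.

Let bnd0 w (r : R) x n : 0 <= r <= T -> size w = n.+1 ->
  `|pderiv T (map Some w) v r x| <= Kt * del ^+ n.
Proof. by move=> rT sw; apply: (bnd (a := 0)). Qed.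

Let bnd1 w (r : R) x n : 0 <= r <= T -> (size w).+1 = n ->
  `|pderiv T (None :: map Some w) v r x| <= Kt * del ^+ n.
Proof. by move=> rT sw; apply: (bnd (a := 1) (w := w)) => //; rewrite -sw. Qed.

Let bnd2 (r : R) x : 0 <= r <= T -> `|pderiv T [:: None; None] v r x| <= Kt * del ^+ 3.
Proof. by move=> rT; apply: (bnd (a := 2) (w := [::])). Qed.

Let pow_le m n : (m <= n)%N -> Kt * del ^+ m <= Kt * del ^+ n.
Proof. by move=> mn; rewrite ler_wpM2l// ler_weXn2l. Qed.

Lemma hessianE (r : R) x i j : hessian T v r x i j = pderiv T [:: Some i; Some j] v r x.
Proof. by rewrite mxE. Qed.

(** Both a third derivative in space and a second derivative in space of the time
derivative are at most Kt del^3. *)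
Lemma hessian_increment_le x z i j :
  `|hessian T v (t + h) (x + z) i j - hessian T v t x i j| <= Kt * del ^+ 3 * (l1 z + h).
Proof.
rewrite [X in X - _]hessianE [X in _ - X]hessianE.
pose w := [:: i; j].
have H1 : `|pderiv T (map Some w) v (t + h) (x + z) - pderiv T (map Some w) v (t + h) x| <= l1 z *
  (Kt * del ^+ 2).
  by apply: (space_increment_le sv) => // u y su; exact: bnd0.
have H2 : `|pderiv T (map Some w) v (t + h) x - pderiv T (map Some w) v t x| <= h * (Kt * del ^+ 3).
  by apply: (time_increment_le sv) => //; [exact: ltW|move=> r rT; exact: bnd1].
rewrite (le_trans (ler_distD (pderiv T (map Some w) v (t + h) x) _ _))//.
rewrite mulrDr lerD//.
  by rewrite (le_trans H1)// mulrC ler_wpM2r ?l1_ge0// pow_le.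
by rewrite (le_trans H2)// mulrC.
Qed.

(** Moves the Hessian of [weighted_taylor_le] back to (t, x); the displacement is
of order h, and the Hessian is already multiplied by h. *)
Lemma weighted_generator_le x S z P (M : 'M[R]_d) C a Ca :
  norm2 S <= C -> l1 z <= h * Ca -> 0 <= a ->
  (forall i j, `|(S *m M *m S^T) i j| <= a) ->
  tame P -> (forall y, P (- y) = P y) ->
  (forall k l, Exm (fun y => y k 0 * y l 0 * P y) = h * M k l) ->
  `|Exm (fun y => v (t + h) (x + z + S *m y) * P y) - v (t + h) (x + z) * Exm P
     - h / 2 * \tr (S *m M *m S^T *m hessian T v t x)|
  <= Kt * del ^+ 3 * ((d%:R * C) ^+ 4 * Exm (fun y => l1 y ^+ 4 * `|P y|)
                      + h ^+ 2 * (d%:R ^+ 2 * a * (Ca + 1))).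
Proof.
move=> SC zCa a0 Ma tP Pe PM.
have H1 := weighted_taylor_le (x + z) SC tP Pe PM.
set A := S *m M *m S^T; set H := hessian T v t x.
have H2 : `|h / 2 * \tr (A *m (hessian T v (t + h) (x + z) - H))| <= Kt * del ^+ 3 * (h ^+ 2 *
  (d%:R ^+ 2 * a * (Ca + 1))).
  rewrite normrM ger0_norm; last by rewrite divr_ge0// ltW.
  rewrite (@le_trans _ _ (h * (d%:R ^+ 2 * (a * (Kt * del ^+ 3 * (h * (Ca + 1)))))))//; last first.
    by rewrite le_eqVlt; apply/orP; left; apply/eqP; ring.
  apply: ler_pM => //; first by rewrite divr_ge0// ltW.
    by rewrite ler_pdivrMr// ler_peMr ?ltW// ltr1n.
  apply: trace_mul_le => // i j.
  have -> : (hessian T v (t + h) (x + z) - H) i j = hessian T v (t + h) (x + z) i j - H i j.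
    by rewrite mxE [X in _ + X]mxE.
  rewrite (le_trans (hessian_increment_le x z i j))//.
  by rewrite ler_wpM2l ?mulr_ge0 ?exprn_ge0// mulrDr mulr1 lerD2r.
rewrite [leRHS]mulrDr [X in _ <= X + _]mulrA (le_trans _ (lerD H1 H2))// (le_trans _ (ler_normD _ _))//.
by rewrite mulmxBr raddfB/= mulrBr addrA subrK.
Qed.

Lemma gradient_increment_le x i :
  `|pderiv T [:: Some i] v (t + h) x - pderiv T [:: Some i] v t x| <= h * (Kt * del ^+ 2).
Proof.
by apply: (time_increment_le sv) => //; [exact: ltW|move=> r rT; exact: (bnd1 (w := [:: i]))].
Qed.

(** First order expansion in time, then in space at time t + h, then transport of
the gradient back to time t: three errors of order h^2. *)
Lemma drift_taylor_le x a Ca : l1 a <= Ca ->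
  `|v (t + h) (x + h *: a) - v t x - h * (time_deriv T v t x + dotp a (gradient T v t x))|
  <= Kt * del ^+ 3 * (h ^+ 2 * (1 + Ca + Ca ^+ 2)).
Proof.
move=> aC.
have l0 := l1_ge0 a; have hge0 := ltW h0.
have H1 : `|v (t + h) x - v t x - h * time_deriv T v t x| <= h ^+ 2 * (Kt * del ^+ 3).
  by apply: (time_taylor_le (s := [::]) sv) => // r rT; exact: bnd2.
have H2 : `|dir_pderiv T v 1 (h *: a) [::] (t + h) x - dir_pderiv T v 1 (h *: a) [::] t x|
    <= h ^+ 2 * Ca * (Kt * del ^+ 3).
  rewrite /= -sumrB (le_trans (ler_norm_sum _ _ _))//.
  rewrite (@le_trans _ _ (\sum_i h * `|a i 0| * (h * (Kt * del ^+ 3))))//.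
    apply: ler_sum => i _; rewrite -mulrBr normrM mxE normrM (ger0_norm (ltW h0)).
    rewrite ler_wpM2l ?mulr_ge0 ?(ltW h0)// (le_trans (gradient_increment_le x i))//.
    by rewrite ler_wpM2l ?(ltW h0)// pow_le.
  rewrite -mulr_suml -mulr_sumr -/(l1 a).
  rewrite (_ : h * _ * _ = h ^+ 2 * (Kt * del ^+ 3) * l1 a); last by ring.
  rewrite [leRHS]mulrAC ler_wpM2l// mulr_ge0 ?sqr_ge0//.
  by rewrite mulr_ge0// exprn_ge0.
have H3 : `|v (t + h) (x + h *: a) - v (t + h) x - dir_pderiv T v 1 (h *: a) [::] (t + h) x|
    <= h ^+ 2 * Ca ^+ 2 * (Kt * del ^+ 3).
  have := space_taylor1_le sv (h *: a) x (B := Kt * del ^+ 1) tT'.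
  move=> /(_ _)/le_trans; apply; first by move=> w y sw; exact: bnd0.
  rewrite l1Z (ger0_norm (ltW h0)) exprMn.
  rewrite ler_pM ?mulr_ge0 ?sqr_ge0 ?exprn_ge0//; last exact: pow_le.
  by rewrite ler_wpM2l ?sqr_ge0// lerXn2r ?nnegrE// (le_trans l0).
have -> : h * (time_deriv T v t x + dotp a (gradient T v t x)) =
    h * time_deriv T v t x + dir_pderiv T v 1 (h *: a) [::] t x.
  rewrite mulrDr dir_pderiv1E /dotp mulr_sumr; congr (_ + _); apply: eq_bigr => i _.
  by rewrite [(h *: a) _ _]mxE mulrA.
have := lerD H1 (lerD H2 H3).
move=> /(fun H => le_trans _ H) -/(_ `|v (t + h) (x + h *: a) - v t x -
 (h * time_deriv T v t x + dir_pderiv T v 1 (h *: a) [::] t x)|) HH.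
apply: (le_trans (HH _)).
  rewrite (le_trans _ (lerD (lexx _) (ler_normD _ _)))// (le_trans _ (ler_normD _ _))//.
  by rewrite le_eqVlt; apply/orP; left; apply/eqP; congr `|_|; ring.
by rewrite le_eqVlt; apply/orP; left; apply/eqP; ring.
Qed.

(** The case P = 1 of [weighted_generator_le], completed by the expansion of v at
the centre of the step. *)
Lemma step_consistency_le x a S C Ca : norm2 S <= C -> l1 a <= Ca ->
  `|Exm (fun y => v (t + h) (x + h *: a + S *m y)) - v t x
    - h * (time_deriv T v t x + dotp a (gradient T v t x)
           + 2^-1 * \tr (S *m S^T *m hessian T v t x))|
  <= Kt * del ^+ 3 * (h ^+ 2 * ((d%:R * C) ^+ 4 * @l1_moment R d 4
       + d%:R ^+ 2 * C ^+ 2 * (Ca + 1) + (1 + Ca + Ca ^+ 2))).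
Proof.
move=> SC aC.
have M1 k l : Exm (fun y => y k 0 * y l 0 * 1) = h * (1%:M : 'M[R]_d) k l.
  by under eq_fun do rewrite mulr1; rewrite (Ex_coord2 s0 muE) s2 mxE.
have zC : l1 (h *: a) <= h * Ca by rewrite l1Z (ger0_norm (ltW h0)) ler_wpM2l// ltW.
have Sa i j : `|(S *m 1%:M *m S^T) i j| <= C ^+ 2 by rewrite mulmx1; exact: gram_entry_le.
have H1 := weighted_generator_le x SC zC (sqr_ge0 C) Sa (tame_cst 1) (fun=> erefl) M1.
have H2 := drift_taylor_le x aC.
have H4 : Exm (fun y => l1 y ^+ 4 * `|1 : R|) <= h ^+ 2 * @l1_moment R d 4.
  under eq_fun do rewrite normr1 mulr1.
  by rewrite (le_trans (Ex_l1X_le s0 muE 4))// s4 mulrC.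
have E1 : Exm (fun y => v (t + h) (x + h *: a + S *m y) * 1) = Exm (fun y => v (t + h) (x + h *: a + S *m y)).
  by congr Ex; apply/funext => y; rewrite mulr1.
rewrite E1 Ex_cst mulr1 mulmx1 in H1.
have P0 : 0 <= Kt * del ^+ 3 by rewrite mulr_ge0// exprn_ge0.
have H5 := ler_wpM2l (exprn_ge0 4 (mulr_ge0 (ler0n R d) (le_trans (norm2_ge0 S) SC))) H4.
apply: (le_trans _ (le_trans (lerD H1 H2) _)).
  rewrite (le_trans _ (ler_normD _ _))//.
  by rewrite le_eqVlt; apply/orP; left; apply/eqP; congr `|_|; field.
rewrite -mulrDr ler_wpM2l//.
by move: H5; set X := Exm _; lra.
Qed.

(** The case P = [poly2] of [weighted_generator_le]; the value of v at the centre
disappears because the weight is centred. *)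
Lemma poly2_consistency_le x a S l (Sig : 'M[R]_(d, l)) k C Ca CS : norm2 S <= C -> l1 a <= Ca ->
  norm2 Sig <= CS ->
  `|Exm (fun y => v (t + h) (x + h *: a + S *m y) * poly2 Sig k (s^-1 *: y))
    - h / 2 * \tr (S *m (Sig *m Sig^T) *m S^T *m hessian T v t x)|
  <= Kt * del ^+ 3 * (h ^+ 2 * ((d%:R * C) ^+ 4 *
       (CS ^+ 2 * (c_coef R k * @l1_moment R d (2 * (2 * k).+1 + 4) + d_coef R k * @l1_moment R d 4))
       + d%:R ^+ 2 * (d%:R * (d%:R * (C * CS ^+ 2) * C)) * (Ca + 1))).
Proof.
move=> SC aC SigC.
have C0 : 0 <= C := le_trans (norm2_ge0 S) SC.
have zC : l1 (h *: a) <= h * Ca by rewrite l1Z (ger0_norm (ltW h0)) ler_wpM2l// ltW.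
have SE i j : `|S i j| <= C := le_trans (abs_le_norm2 S i j) SC.
have Sa i j : `|(S *m (Sig *m Sig^T) *m S^T) i j| <= d%:R * (d%:R * (C * CS ^+ 2) * C).
  apply: mulmx_entry_le => [||]; last by rewrite mulr_ge0// mulr_ge0// sqr_ge0.
    by apply: mulmx_entry_le => //; exact: gram_entry_le.
  by move=> i' j'; rewrite mxE.
have a0 : 0 <= d%:R * (d%:R * (C * CS ^+ 2) * C) by rewrite mulr_ge0// mulr_ge0// mulr_ge0// mulr_ge0// sqr_ge0.
have := weighted_generator_le x SC zC a0 Sa (tame_poly2 h k Sig) (poly2N h k Sig) (Ex_coord2_poly2
  h0 muE k Sig).
rewrite (Ex_poly2 h0 muE) mulr0 subr0 => /le_trans; apply.
rewrite ler_wpM2l ?mulr_ge0 ?exprn_ge0// [leRHS]mulrDr lerD2r mulrCA.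
by rewrite ler_wpM2l ?exprn_ge0 ?mulr_ge0//; exact: Ex_l1_poly2_le.
Qed.

(** Split the increment of v into its linear part L in y, whose weighted
expectation is exact, and a remainder r. *)
Lemma poly1_consistency_le x a S g C Ca Cg : norm2 S <= C -> l1 a <= Ca -> norm2 g <= Cg ->
  `|Exm (fun y => (v (t + h) (x + h *: a + S *m y) - v t x) * poly1 g (h^-1 *: y))
    - dotp (S *m g) (gradient T v t x)|
  <= Kt * del * (s * (1 + h) * (2 * Cg * ((Ca + 1 + 2 * Ca ^+ 2) * @l1_moment R d 1
       + 2 * (d%:R * C) ^+ 2 * @l1_moment R d 3))).
Proof.
move=> SC aC gC.
pose P y := poly1 g (h^-1 *: y).
have tP : tame P by exact: tame_poly1.
have C0 : 0 <= C := le_trans (norm2_ge0 S) SC.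
have Cg0 : 0 <= Cg := le_trans (norm2_ge0 g) gC.
have Ca0 : 0 <= Ca := le_trans (l1_ge0 a) aC.
have Kd0 : 0 <= Kt * del by rewrite mulr_ge0.
pose L y := \sum_i gradient T v t x i 0 * \sum_j S i j * y j 0.
have tL : tame L.
  by apply: tame_sum => i; apply: tameZ; apply: tame_sum => j; apply: tameZ; exact: tame_coord.
pose r y := v (t + h) (x + h *: a + S *m y) - v t x - L y.
have tr : tame r.
  apply: tameB => //; apply: tameB; last exact: tame_cst.
  exact: tame_affine.
have ELP : Exm (fun y => L y * P y) = dotp (S *m g) (gradient T v t x).
  have tyP j : tame (fun y => y j 0 * P y) by apply: tameM => //; exact: tame_coord.
  rewrite (_ : (fun y => _) = fun y => \sum_i gradient T v t x i 0 * \sum_j S i j * (y j 0 * P y)).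
    rewrite (Ex_sum s0 muE); last first.
      by move=> i; apply: tameZ; apply: tame_sum => j; exact: tameZ.
    apply: eq_bigr => i _; rewrite (ExZ s0 muE); last by apply: tame_sum => j; exact: tameZ.
    rewrite mulrC (Ex_sum s0 muE); last by move=> j; exact: tameZ.
    congr (_ * _); rewrite mxE; apply: eq_bigr => j _.
    by rewrite (ExZ s0 muE)// (Ex_coord_poly1 h0 muE).
  apply/funext => y; rewrite /L mulr_suml; apply: eq_bigr => i _.
  rewrite -mulrA mulr_suml; congr (_ * _); apply: eq_bigr => j _; by rewrite mulrA.
have rB y : `|r y| <= Kt * del * (h * Ca + h + 2 * (h * Ca) ^+ 2 + 2 * (d%:R * C) ^+ 2 * l1 y ^+ 2).
  (* time increment at the far point, then Taylor expansion in space at time t *)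
  pose Y := h *: a + S *m y.
  have l1Y : l1 Y <= h * Ca + d%:R * C * l1 y.
    rewrite (le_trans (l1D _ _))// lerD ?l1_mulmx// l1Z (ger0_norm (ltW h0)).
    by rewrite ler_wpM2l// ltW.
  have H1 : `|v (t + h) (x + Y) - v t (x + Y)| <= h * (Kt * del ^+ 1).
    by apply: (time_increment_le (s := [::]) sv) => //; [exact: ltW|move=> u uT; exact: (bnd1 (w := [::]))].
  have H2 : `|v t (x + Y) - v t x - dir_pderiv T v 1 Y [::] t x| <= l1 Y ^+ 2 * (Kt * del ^+ 1).
    by apply: (space_taylor1_le sv Y x tT) => w z sw; exact: bnd0.
  have H3 : `|h * dotp a (gradient T v t x)| <= h * Ca * (Kt * del).
    rewrite normrM (ger0_norm (ltW h0)) -mulrA ler_wpM2l ?(ltW h0)//.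
    rewrite (_ : dotp _ _ = dotp (gradient T v t x) a); last first.
      by apply: eq_bigr => i _; rewrite mulrC.
    rewrite (@le_trans _ _ (Kt * l1 a))//.
      apply: dotp_le_l1 => i; rewrite mxE.
      by have := @bnd0 [:: i] t x 0%N tT erefl; rewrite expr0 mulr1.
    rewrite mulrC ler_pM ?l1_ge0//.
    by rewrite ler_peMr.
  have rE : r y = (v (t + h) (x + Y) - v t (x + Y)) + (v t (x + Y) - v t x - dir_pderiv T v 1 Y [::] t x)
      + h * dotp a (gradient T v t x).
    rewrite /r -[x + h *: a + S *m y]addrA -/Y.
    have -> : dir_pderiv T v 1 Y [::] t x = h * dotp a (gradient T v t x) + L y.
      rewrite dir_pderiv1E /dotp mulr_sumr -big_split/=; apply: eq_bigr => i _.
      rewrite [(h *: a + S *m y) _ _]mxE [(h *: a) _ _]mxE [(S *m y) _ _]mxE; ring.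
    ring.
  rewrite rE (le_trans (ler_normD _ _))// (le_trans (lerD (ler_normD _ _) (lexx _)))//.
  rewrite expr1 in H1 H2.
  rewrite (le_trans (lerD (lerD H1 H2) H3))//.
  have l1Y2 : l1 Y ^+ 2 <= 2 * (h * Ca) ^+ 2 + 2 * (d%:R * C) ^+ 2 * l1 y ^+ 2.
    have : l1 Y ^+ 2 <= (h * Ca + d%:R * C * l1 y) ^+ 2.
      by rewrite lerXn2r ?nnegrE ?l1_ge0// (le_trans (l1_ge0 Y)).
    have := sqr_ge0 (h * Ca - d%:R * C * l1 y).
    by move: (h * Ca) (d%:R * C) => u w; nra.
  by have := ler_wpM2r Kd0 l1Y2; lra.
have HP y : `|P y| <= 2 * Cg * h^-1 * l1 y.
  rewrite (le_trans (poly1_abs_le _ gC))// l1Z ger0_norm ?invr_ge0 ?(ltW h0)//.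
  by rewrite mulrA.
pose A := h * Ca + h + 2 * (h * Ca) ^+ 2.
pose G y := Kt * del * (2 * Cg * h^-1) * (A * l1 y ^+ 1 + 2 * (d%:R * C) ^+ 2 * l1 y ^+ 3).
have tl n : tame (fun y => l1 y ^+ n) by apply: tameX; exact: tame_l1.
have tG : tame G by apply: tameZ; apply: tameD; exact: tameZ.
have E : Exm (fun y => (v (t + h) (x + h *: a + S *m y) - v t x) * P y)
    - dotp (S *m g) (gradient T v t x) = Exm (fun y => r y * P y).
  rewrite -ELP -(ExB s0 muE).
  - by congr Ex; apply/funext => y; rewrite /r [RHS]mulrBl.
  - apply: tameM => //; apply: tameB; last exact: tame_cst.
    exact: tame_affine.
  - exact: tameM.
rewrite E (le_trans (Ex_norm_le s0 muE _ tG _))//.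
- exact: tameM.
- move=> y; rewrite normrM (le_trans (ler_pM _ _ (rB y) (HP y)))//.
  by rewrite /G /A le_eqVlt; apply/orP; left; apply/eqP; ring.
have G0 : 0 <= Kt * del * (2 * Cg * h^-1) by rewrite !mulr_ge0// invr_ge0 ltW.
rewrite /G (ExZ s0 muE) ?(ExD s0 muE) ?(ExZ s0 muE)//; try exact: tameZ.
  have m1 := Ex_l1X_le s0 muE 1; have m3 := Ex_l1X_le s0 muE 3.
  have A0 : 0 <= A by rewrite !addr_ge0 ?mulr_ge0 ?exprn_ge0 ?mulr_ge0 ?(ltW h0)//.
  have B0 : 0 <= 2 * (d%:R * C) ^+ 2 by rewrite mulr_ge0// sqr_ge0.
  rewrite (le_trans (ler_wpM2l G0 (lerD (ler_wpM2l A0 m1) (ler_wpM2l B0 m3))))//.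
  rewrite [s ^+ 3]exprS s2.
  have -> : Kt * del * (2 * Cg * h^-1) * (A * (@l1_moment R d 1 * s ^+ 1) + 2 * (d%:R * C) ^+ 2 *
    (@l1_moment R d 3 * (s * h)))
     = Kt * del * (s * (2 * Cg * ((Ca + 1 + 2 * Ca ^+ 2 * h) * @l1_moment R d 1 + 2 * (d%:R * C) ^+
       2 * @l1_moment R d 3))).
    by rewrite /A expr1; field; rewrite gt_eqF.
  rewrite ler_wpM2l// -[leRHS]mulrA ler_wpM2l ?(ltW s0)// [leRHS]mulrCA ler_wpM2l ?mulr_ge0//.
  rewrite [leRHS]mulrDr lerD//.
    rewrite [leRHS]mulrA ler_wpM2r ?l1_moment_ge0//.
    have := sqr_ge0 Ca; have := ltW h0; have := mulr_ge0 (ltW h0) Ca0; lra.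
  by rewrite ler_peMl ?mulr_ge0 ?l1_moment_ge0// lerDl ltW.
by apply: tameD; exact: tameZ.
Qed.

End local.

(** * Brownian increments *)

Section brownian.
Context {R : realType} {d : nat} {dO : measure_display} {Omega : measurableType dO}.
Variables (P : probability Omega R) (W : R -> Omega -> 'cV[R]_d).
Hypothesis BW : brownian_motion P W.
Variables (h t : R).
Hypotheses (h0 : 0 < h) (t0 : 0 <= t).

Let X : Omega -> gvec R d := fun w => W (t + h) w - W t w.

Lemma measurable_increment : measurable_fun setT X.
Proof.
have [mW _ _ _ _] := BW.
apply: measurable_gvec => i; rewrite /X.
rewrite (_ : (fun w => _) = (fun w => W (t + h) w i 0 - W t w i 0)).
  by apply: measurable_funB; apply: mW => //; rewrite addr_ge0// ltW.
by apply/funext => w; rewrite !mxE.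
Qed.

Let X' : {mfun Omega >-> gvec R d} := HB.pack X (isMeasurableFun.Build _ _ _ _ X measurable_increment).

Definition increment_law : probability (gvec R d) R := distribution P X'.

Lemma increment_lawE (B : set (gvec R d)) : measurable B ->
  P (X @^-1` B) = increment_law B.
Proof. by []. Qed.

(** Independence of the increments over the one interval [t, t + h], applied to all
coordinates together. *)
Lemma increment_law_box (A : 'I_d -> set R) : (forall i, measurable (A i)) ->
  increment_law (box A) = (\prod_i fine (normal_prob 0 (Num.sqrt h) (A i)))%:E.
Proof.
move=> mA; have [_ _ _ nW ind] := BW.
have homt : {homo (fun n : nat => if n is 0%N then t else t + h) : i j / (i <= j)%N >-> i <= j}.
  by move=> [|i] [|j] //= _; rewrite lerDl ltW.
have := ind 1%N _ t0 homt (fun a => A a.2) (fun a => mA a.2).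
have -> : [set w | forall a : 'I_1 * 'I_d, A a.2 ((W (t + h) w - W (if nat_of_ord a.1 is 0%N then t
  else t + h) w) a.2 0)]
    = X @^-1` box A.
  apply/seteqP; split => w /= Aw; first by move=> i; exact: (Aw (ord0, i)).
  by move=> [a i] /=; rewrite (ord1 a); exact: (Aw i).
move=> E; rewrite [LHS](E); congr EFin.
rewrite -(pair_bigA _ (fun (a : 'I_1) i => fine (P ((fun w : Omega => (W (t + h) w -
  W (if nat_of_ord a is 0%N then t else t + h) w) i 0) @^-1` A i)))) big_ord1/=.
apply: eq_bigr => i _; congr fine.
have th : t < t + h by rewrite ltrDl.
by rewrite (nW t (t + h) i t0 th (A i) (mA i)) addrAC subrr add0r.
Qed.

Lemma cond_expectE fl (sl : 'cV[R]_d -> 'M[R]_d) x G :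
  tame (fun y => G (x + h *: fl x + sl x *m y) y) ->
  cond_expect P W h fl sl t x G =
  Ex increment_law (fun y => G (x + h *: fl x + sl x *m y) y).
Proof.
move=> tF; have [mF _] := tF.
have h0' : 0 < Num.sqrt h by rewrite sqrtr_gt0.
have iF := tame_integrable h0' increment_law_box tF.
have iX := integrable_transfer measurable_increment increment_lawE mF iF.
rewrite /cond_expect unlock /Ex /Rintegral; congr fine.
by rewrite (integral_transfer measurable_increment increment_lawE mF iX).
Qed.

End brownian.

(** * From one control to the maxima *)

Lemma sup_dist_le (R : realType) (A B : set R) (c E : R) : max_attained A -> max_attained B ->
  (forall a, A a -> exists2 b, B b & `|a - (b + c)| <= E) ->
  (forall b, B b -> exists2 a, A a & `|a - (b + c)| <= E) ->
  `|sup A - (sup B + c)| <= E.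
Proof.
have attained (C : set R) : max_attained C -> C (sup C) /\ ubound C (sup C).
  move=> [y Cy yC]; have -> : sup C = y; last by [].
  apply/eqP; rewrite eq_le; apply/andP; split; first by apply: ge_sup => //; exists y.
  by apply: ub_le_sup => //; exists y.
move=> /attained[Aa Ab] /attained[Ba Bb] AB BA.
have [b Bb' H1] := AB _ Aa; have [a Aa' H2] := BA _ Ba.
have := Bb _ Bb'; have := Ab _ Aa'.
by move: H1 H2; rewrite !ler_norml; lra.
Qed.

Definition step_const (R : realType) (d : nat) (C Ca : R) : R :=
  (d%:R * C) ^+ 4 * @l1_moment R d 4 + d%:R ^+ 2 * C ^+ 2 * (Ca + 1) + (1 + Ca + Ca ^+ 2).

Definition poly1_const (R : realType) (d : nat) (C Ca Cg : R) : R :=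
  2 * Cg * ((Ca + 1 + 2 * Ca ^+ 2) * @l1_moment R d 1
       + 2 * (d%:R * C) ^+ 2 * @l1_moment R d 3).

Definition poly2_const (R : realType) (d k : nat) (C Ca CS : R) : R :=
  (d%:R * C) ^+ 4 *
       (CS ^+ 2 * (c_coef R k * @l1_moment R d (2 * (2 * k).+1 + 4) + d_coef R k * @l1_moment R d 4))
       + d%:R ^+ 2 * (d%:R * (d%:R * (C * CS ^+ 2) * C)) * (Ca + 1).

Lemma step_const_ge0 (R : realType) d (C Ca : R) : 0 <= C -> 0 <= Ca -> 0 <= step_const d C Ca.
Proof.
by move=> C0 Ca0; rewrite /step_const !addr_ge0// ?mulr_ge0 ?exprn_ge0 ?mulr_ge0 ?l1_moment_ge0 ?addr_ge0.
Qed.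

Lemma poly1_const_ge0 (R : realType) d (C Ca Cg : R) : 0 <= C -> 0 <= Ca -> 0 <= Cg -> 0 <=
  poly1_const d C Ca Cg.
Proof.
move=> C0 Ca0 Cg0; have m1 := @l1_moment_ge0 R d 1; have m3 := @l1_moment_ge0 R d 3.
rewrite /poly1_const mulr_ge0 ?mulr_ge0// addr_ge0// mulr_ge0//; last by rewrite mulr_ge0// sqr_ge0.
by rewrite !addr_ge0// mulr_ge0// sqr_ge0.
Qed.

Lemma poly2_const_ge0 (R : realType) d k (C Ca CS : R) : 0 <= C -> 0 <= Ca -> 0 <= CS -> 0 <=
  poly2_const d k C Ca CS.
Proof.
move=> C0 Ca0 CS0; rewrite /poly2_const addr_ge0// ?mulr_ge0 ?exprn_ge0 ?mulr_ge0 ?exprn_ge0 ?addr_ge0//.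
- by rewrite mulr_ge0 ?c_coef_ge0 ?l1_moment_ge0.
- by rewrite mulr_ge0 ?d_coef_ge0 ?l1_moment_ge0.
Qed.

Section consistency.
Context {R : realType} {d : nat} {dO : measure_display} {Omega : measurableType dO}.
Variables (P : probability Omega R) (W : R -> Omega -> 'cV[R]_d).
Hypothesis BW : brownian_motion P W.
Variables (T : R) (v : R -> 'cV[R]_d -> R).
Hypothesis sv : smooth_bounded T v.
Variables (h t Kt del : R).
Hypotheses (h0 : 0 < h) (t0 : 0 <= t) (thT : t + h <= T) (del1 : 1 <= del) (Kt0 : 0 <= Kt).
Hypothesis bnd : forall a w (r : R) x n, 0 <= r <= T -> (2 * a + size w = n.+1)%N ->
  `|pderiv T (nseq a None ++ map Some w) v r x| <= Kt * del ^+ n.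

(** The three consistency estimates added up, for one control. The common term e
stands for ell - delta r, which the scheme and the Hamiltonian share. *)
Lemma scheme_consistency_le (x : 'cV[R]_d) fl (sl : 'cV[R]_d -> 'M[R]_d) (g f : 'cV[R]_d)
    l (Sig : 'M[R]_(d, l)) k (sigma : 'M[R]_d) (e C Ca Cg CS : R) :
  norm2 (sl x) <= C -> l1 (fl x) <= Ca -> norm2 g <= Cg -> norm2 Sig <= CS ->
  sigma *m sigma^T - sl x *m (sl x)^T = sl x *m Sig *m Sig^T *m (sl x)^T ->
  f - fl x = sl x *m g ->
  `|(h^-1 * (D0 P W h fl sl v t x - v t x) + e
      + D1 P W h fl sl g (v t x) v t x + D2 P W h fl sl Sig k v t x)
    - (2^-1 * \tr (sigma *m sigma^T *m hessian T v t x) + dotp f (gradient T v t x) + e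
       + time_deriv T v t x)|
  <= Kt * (h * del ^+ 3 * (step_const d C Ca + poly2_const d k C Ca CS)
           + Num.sqrt h * (1 + h) * del * poly1_const d C Ca Cg).
Proof.
move=> SC aC gC SigC sE fE.
have tT' : 0 <= t + h <= T by rewrite thT addr_ge0// ltW.
have tf : tame (fun y => v (t + h) (x + h *: fl x + sl x *m y)) by exact: tame_affine.
have muE := increment_law_box BW h0 t0.
have H0 := step_consistency_le sv h0 muE t0 thT del1 Kt0 bnd x SC aC.
have H1 := poly1_consistency_le sv h0 muE t0 thT del1 Kt0 bnd x SC aC gC.
have H2 := poly2_consistency_le sv h0 muE t0 thT del1 Kt0 bnd x k SC aC SigC.
rewrite /D0 /D1 /D2 !(cond_expectE BW h0 t0)//; last 2 first.
- by apply: tameM => //; exact: tame_poly2.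
- apply: tameM; last exact: tame_poly1.
  by apply: tameB => //; exact: tame_cst.
have -> : sigma *m sigma^T = sl x *m (sl x)^T + sl x *m (Sig *m Sig^T) *m (sl x)^T.
  by rewrite -[LHS](subrK (sl x *m (sl x)^T)) sE addrC !mulmxA.
have -> : f = fl x + sl x *m g by rewrite -fE addrC subrK.
rewrite dotpDl mulmxDl mxtraceD.
move: H0 H1 H2; set X0 := Ex _ _; set X1 := Ex _ _; set X2 := Ex _ _.
set tr0 := \tr _; set tr2 := \tr _; set g0 := dotp _ _; set g1 := dotp _ _; set td := time_deriv _ _ _ _.
rewrite -/(step_const d C Ca) -/(poly1_const d C Ca Cg) -/(poly2_const d k C Ca CS) => H0 H1 H2.
have hi : 0 <= h^-1 by rewrite invr_ge0 ltW.
have -> : (h^-1 * (X0 - v t x) + e + X1 + h^-1 * X2)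
    - (2^-1 * (tr0 + tr2) + (g0 + g1) + e + td) =
  h^-1 * (X0 - v t x - h * (td + g0 + 2^-1 * tr0)) + (X1 - g1) + h^-1 * (X2 - h / 2 * tr2).
  by field; rewrite gt_eqF.
rewrite (le_trans (ler_normD _ _))// (le_trans (lerD (ler_normD _ _) (lexx _)))//.
rewrite !normrM (ger0_norm hi).
rewrite (le_trans (lerD (lerD (ler_wpM2l hi H0) H1) (ler_wpM2l hi H2)))//.
by rewrite le_eqVlt; apply/orP; left; apply/eqP; field; rewrite gt_eqF.
Qed.

End consistency.

Lemma error_bound_le (R : realType) (Ka Kb Kt h eps : R) : 0 < h -> 0 < eps ->
  0 <= Ka -> 0 <= Kb -> 0 <= Kt ->
  Kt * (h * eps^-1 ^+ 3 * Ka + Num.sqrt h * (1 + h) * eps^-1 * Kb) <= error_bound (Ka + Kb) Kt h eps.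
Proof.
move=> h0 e0 Ka0 Kb0 Kt0.
have s0 : 0 <= Num.sqrt h by exact: sqrtr_ge0.
have s2 : Num.sqrt h ^+ 2 = h by rewrite sqr_sqrtr// ltW.
rewrite /error_bound -exprVn.
set s := Num.sqrt h in s0 s2 *; set D := eps^-1.
have D0 : 0 <= D by rewrite invr_ge0 ltW.
have p1 n : 1 <= (1 + s) ^+ n by rewrite exprn_ege1// lerDl.
have p2 n : 1 <= (1 + s * D) ^+ n by rewrite exprn_ege1// lerDl mulr_ge0.
rewrite [(Ka + Kb) * Kt]mulrC -[leRHS]mulrA ler_wpM2l//.
set X := h * D ^+ 3 * _ * _; set Y := s * D * _ * _.
have HX : h * D ^+ 3 <= X.
  have hD : 0 <= h * D ^+ 3 by rewrite mulr_ge0 ?exprn_ge0// ltW.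
  rewrite /X (@le_trans _ _ (h * D ^+ 3 * (1 + s) ^+ 4))// ?ler_peMr//.
  by rewrite mulr_ge0// (le_trans ler01).
have HY : s * (1 + h) * D <= Y.
  have sD : 0 <= s * D by rewrite mulr_ge0.
  rewrite /Y (@le_trans _ _ (s * D * (1 + s) ^+ 2))//.
    by rewrite mulrAC ler_wpM2l//; nra.
  by rewrite ler_peMr// mulr_ge0// (le_trans ler01).
have X0 : 0 <= X by rewrite (le_trans _ HX)// mulr_ge0 ?exprn_ge0// ltW.
have Y0 : 0 <= Y by rewrite (le_trans _ HY)// !mulr_ge0// addr_ge0// ltW.
have := ler_wpM2r Ka0 HX; have := ler_wpM2r Kb0 HY.
have := mulr_ge0 Ka0 Y0; have := mulr_ge0 Kb0 X0; lra.
Qed.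

Theorem theorem4p1 (R : realType) (d k : nat) (Csl Cfl Cg CSig : R) :
  exists K : R,
  forall (M : finType) (p l : nat) (U : set 'cV[R]_p) (T : R)
    (f : M -> 'cV[R]_d -> 'cV[R]_p -> 'cV[R]_d)
    (sigma : M -> 'cV[R]_d -> 'cV[R]_p -> 'M[R]_d)
    (delta ell : M -> 'cV[R]_d -> 'cV[R]_p -> R)
    (fl : M -> 'cV[R]_d -> 'cV[R]_d) (sl : M -> 'cV[R]_d -> 'M[R]_d)
    (g : M -> 'cV[R]_d -> 'cV[R]_p -> 'cV[R]_d)
    (Sig : M -> 'cV[R]_d -> 'cV[R]_p -> 'M[R]_(d, l)),
  0 < T ->
  (forall m, [/\ continuous_coef U (f m), continuous_coef U (sigma m),
                 continuous_coef U (delta m) & continuous_coef U (ell m)]) ->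
  decomposition U f sigma fl sl g Sig ->
  (forall m x, norm2 (sl m x) <= Csl) ->
  (forall m x, norm2 (fl m x) <= Cfl) ->
  (forall m x u, U u -> norm2 (g m x u) <= Cg) ->
  (forall m x u, U u -> norm2 (Sig m x u) <= CSig) ->
  forall (h : R) (dO : measure_display) (Omega : measurableType dO)
    (P : probability Omega R) (W : R -> Omega -> 'cV[R]_d),
  0 < h -> T / h \is a Num.nat ->
  brownian_motion P W ->
  forall (eps Kt : R) (v : R -> 'cV[R]_d -> R),
  0 < eps <= 1 ->
  smooth_bounded T v ->
  (forall a b : nat,
     deriv_seminorm T v a b <= Kt * eps ^ (1 - 2 * a%:Z - b%:Z)) ->
  forall (t : R) (x : 'cV[R]_d),
  time_grid h T t ->
  max_attained (scheme_set k P W U delta ell fl sl g Sig h t x (v t x) v) ->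
  max_attained (hamiltonian_set U f sigma delta ell x (v t x)
                  (gradient T v t x) (hessian T v t x)) ->
  `|scheme k P W U delta ell fl sl g Sig h t x (v t x) v
    + time_deriv T v t x
    + hamiltonian U f sigma delta ell x (v t x)
        (gradient T v t x) (hessian T v t x)|
  <= error_bound K Kt h eps.
Proof.
exists (step_const d Csl (d%:R * Cfl) + poly2_const d k Csl (d%:R * Cfl) CSig + poly1_const d Csl
  (d%:R * Cfl) Cg).
move=> M p l U T f sigma delta ell fl sl g Sig T0 _ [_ dec] HC Hf Hg HS h dO Omega P W h0 _ BW.
move=> eps Kt v /andP[e0 e1] sv sem t x [n tE tTh] maxA maxB.
have t0 : 0 <= t by rewrite tE mulr_ge0// ltW.
have thT : t + h <= T by rewrite -lerBrDr.
have tT : 0 <= t <= T by rewrite t0 (le_trans _ thT)// lerDl ltW.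
have Kt0 : 0 <= Kt.
  have := le_trans (pderiv_le_seminorm sv 0 [::] x tT) (sem 0%N 0%N).
  move=> /(le_trans (normr_ge0 _)); rewrite mulr0 !subr0 expr1z pmulr_lge0//.
have bnd a w (r : R) y m : 0 <= r <= T -> (2 * a + size w = m.+1)%N ->
    `|pderiv T (nseq a None ++ map Some w) v r y| <= Kt * eps^-1 ^+ m.
  move=> rT aw; rewrite (le_trans (pderiv_le_seminorm sv a w y rT))//.
  rewrite (le_trans (sem a (size w)))// le_eqVlt; apply/orP; left; apply/eqP.
  congr (_ * _); rewrite exprVn.
  have -> : (1 - 2 * a%:Z - (size w)%:Z)%R = - m%:Z.
    by rewrite -addrA -opprD -PoszM -PoszD aw intS opprD addrA subrr add0r.
  by rewrite -exprnN.
have del1 : 1 <= eps^-1 by rewrite invf_ge1.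
have key m u (Uu : U u) := let: And3 _ sE fE := dec m x u Uu in
  scheme_consistency_le BW sv h0 t0 thT del1 Kt0 bnd (x := x) (fl := fl m) (sl := sl m) k
  (ell m x u - delta m x u * v t x) (HC m x)
  (l1_bound (fun i => le_trans (abs_le_norm2 (fl m x) i 0) (Hf m x)))
  (Hg m x u Uu) (HS m x u Uu) sE fE.
(* some control exists because a maximum is attained; the bounds are thus nonnegative *)
have [_ [m [u [Uu _]]] _] := maxA.
have C0 := le_trans (norm2_ge0 _) (HC m x).
have Cf0 := le_trans (norm2_ge0 _) (Hf m x).
have Cg0 := le_trans (norm2_ge0 _) (Hg m x u Uu).
have CS0 := le_trans (norm2_ge0 _) (HS m x u Uu).
have Ca0 : 0 <= d%:R * Cfl by rewrite mulr_ge0.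
rewrite (le_trans _ (error_bound_le h0 e0 _ _ Kt0))//; last 2 first.
- by rewrite addr_ge0 ?step_const_ge0 ?poly2_const_ge0.
- by rewrite poly1_const_ge0.
rewrite /scheme /hamiltonian -normrN !opprD opprK -addrA -opprD [X in - X]addrC.
apply: sup_dist_le => // [_ [m' [u' [Uu' ->]]]|_ [m' [u' [Uu' ->]]]].
- eexists; first by exists m', u'; split.
  have := key m' u' Uu'; rewrite !addrA; apply: le_trans.
  by rewrite le_eqVlt; apply/orP; left; apply/eqP; congr `|_|; ring.
- eexists; first by exists m', u'; split.
  have := key m' u' Uu'; rewrite !addrA; apply: le_trans.
  by rewrite le_eqVlt; apply/orP; left; apply/eqP; congr `|_|; ring.
Qed.
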